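(* Let $K$ be a field of characteristic not $2$, let $f \in K[x]$ be a polynomial of even degree $d$, and let $t$ be an indeterminate. Assume that the Galois group of the splitting field of $f(x)-t$ over $K(t)$, acting on the $d$ roots, is $A_d$ or $S_d$. Fix a separable closure $K^{\mathrm{sep}}$ of $K$, let $\Gamma$ be the multiset of roots of $f'(x)$ in $K^{\mathrm{sep}}$ (with multiplicities), and for $n \geq 0$ let $\Gamma_n$ be the multiset $f^{\circ n}(\Gamma)$. Let $\Gamma_n'$ be the set of elements having odd multiplicity in $\Gamma_n$. Assume that for every $n \geq 0$ the set $\Gamma_n'$ is not contained in $\bigcup_{0 \leq i < n} \Gamma_i'$. Then the arboreal Galois representation attached to $f$ and the point $t$ over the base field $K(t)$ is surjective.
   Context: $f^{\circ n}$ is the $n$-th iterate of $f$, $f^{\circ 0}(x)=x$. For a field $L$, $f \in L[x]$ of degree $d\ge 2$, and $t \in L$ not periodic under $f$ with all $f^{\circ n}(x)-t$ separable: the preimage tree $T_\infty$ has as vertices the roots in a separable closure $L^{\mathrm{sep}}$ of $f^{\circ n}(x)-t$ for all $n\geq 0$ (level $n$; root $t$), with an edge between $\alpha,\beta$ whenever $f(\alpha)=\beta$; it is a complete rooted $d$-ary tree. The Galois action gives $\phi:\operatorname{Gal}(L^{\mathrm{sep}}/L)\to\operatorname{Aut}(T_\infty)$, the arboreal Galois representation. Here $L = K(t)$ with $t$ transcendental over $K$.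
   Formalization: Γ is taken as the multiset of all roots of f′, in any extension of K over which f′ splits (K^sep if it suffices, else an algebraic closure); if inseparable roots of f′ were dropped the claim would fail, e.g. f = x²(x³−a)(ex−1)+g over F_3(a,e,g). *)

(* Defs.v *)
From HB Require Import structures.
From mathcomp Require Import all_boot all_order all_algebra all_fingroup.
From mathcomp Require Import all_solvable all_field.
From mathcomp Require Import boolp classical_sets.

Set Implicit Arguments.
Unset Strict Implicit.
Unset Printing Implicit Defensive.

Import GRing.Theory.
Local Open Scope ring_scope.

Definition iter_poly (R : comNzRingType) (f : {poly R}) (n : nat) : {poly R} :=
  iter n (fun q => f \Po q) 'X.

(** Separable closures and absolute Galois groups.  [fieldExtType] covers finite
    extensions only, so a general extension M/L is an embedding of L in M. *)

Definition separable_over (L M : fieldType) (i : {rmorphism L -> M}) (x : M) :=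
  exists p : {poly L},
    [/\ irreducible_poly p, separable_poly p & root (map_poly i p) x].

Definition separably_closed (M : fieldType) :=
  forall p : {poly M}, separable_poly p -> (1 < size p)%N -> exists x, root p x.

Definition is_sep_closure (L M : fieldType) (i : {rmorphism L -> M}) :=
  (forall x, separable_over i x) /\ separably_closed M.

Record gal_aut (L M : fieldType) (i : {rmorphism L -> M}) := GalAut {
  gal_map :> {rmorphism M -> M};
  gal_bij : bijective gal_map;
  gal_fix : forall x, gal_map (i x) = i x }.

(** Preimage trees. *)

Section PreimageTree.
Variables (L M : fieldType) (i : {rmorphism L -> M}) (f : {poly L}) (t : L).

Definition level_poly (n : nat) : {poly M} := map_poly i (iter_poly f n - t%:P).

Definition vertex := {x : M | exists n, root (level_poly n) x}.

Lemma root_vertexP : exists n, root (level_poly n) (i t).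
Proof.
by exists 0%N; rewrite /level_poly rmorphB /= map_polyX map_polyC root_XsubC.
Qed.

Definition root_vertex : vertex := exist _ (i t) root_vertexP.

Definition adj (x y : vertex) : Prop :=
  (map_poly i f).[sval x] = sval y \/ (map_poly i f).[sval y] = sval x.

Record tree_aut := TreeAut {
  tree_map :> vertex -> vertex;
  tree_bij : bijective tree_map;
  tree_root : tree_map root_vertex = root_vertex;
  tree_adj : forall x y, adj (tree_map x) (tree_map y) <-> adj x y }.

Lemma gal_map_poly (s : gal_aut i) (p : {poly L}) x :
  s (map_poly i p).[x] = (map_poly i p).[s x].
Proof.
rewrite -horner_map -map_poly_comp; congr horner.
by apply: eq_map_poly => a /=; exact: gal_fix.
Qed.

Lemma gal_vertexP (s : gal_aut i) x :
  (exists n, root (level_poly n) x) -> exists n, root (level_poly n) (s x).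
Proof.
by move=> [n /rootP xn]; exists n; apply/rootP; rewrite -gal_map_poly xn rmorph0.
Qed.

Definition gal_vertex (s : gal_aut i) (v : vertex) : vertex :=
  exist _ (s (sval v)) (gal_vertexP s (svalP v)).

Lemma vertex_inj (u v : vertex) : sval u = sval v -> u = v.
Proof. by case: u v => [x p] [y q] /= xy; exact: eq_exist. Qed.

Lemma gal_vertex_bij (s : gal_aut i) : bijective (gal_vertex s).
Proof.
have [g sK gK] := gal_bij s.
have gV x : (exists n, root (level_poly n) x) ->
    exists n, root (level_poly n) (g x).
  move=> [n /rootP xn]; exists n; apply/rootP.
  by apply: (can_inj sK); rewrite gal_map_poly gK xn rmorph0.
exists (fun v => exist _ (g (sval v)) (gV _ (svalP v))) => v;
  by apply: vertex_inj => /=.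
Qed.

Lemma gal_vertex_root (s : gal_aut i) : gal_vertex s root_vertex = root_vertex.
Proof. by apply: vertex_inj; exact: gal_fix. Qed.

Lemma gal_vertex_adj (s : gal_aut i) x y :
  adj (gal_vertex s x) (gal_vertex s y) <-> adj x y.
Proof.
rewrite /adj /= -!gal_map_poly.
have sI := bij_inj (gal_bij s).
split=> [[/sI|/sI]|[->|->]]; by [left | right].
Qed.

Definition arboreal_rep (s : gal_aut i) : tree_aut :=
  TreeAut (gal_vertex_bij s) (gal_vertex_root s) (@gal_vertex_adj s).

End PreimageTree.

(** The base field K(t). *)

Section RationalFunctions.
Variable K : fieldType.

Definition ratfun : fieldType := {fraction {poly K}}.

Definition ratfunX : ratfun := tofrac ('X : {poly K}).

Definition ratfun_poly (f : {poly K}) : {poly ratfun} :=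
  map_poly (@tofrac {poly K} \o polyC) f.

End RationalFunctions.

(** The permutations induced on [rs] by the Galois group of E over its base
    field, when [rs] lists a Galois-stable set without repetition. *)
Definition gal_perms (F : fieldType) (E : splittingFieldType F) (d : nat)
    (rs : d.-tuple E) : {set 'S_d} :=
  [set s : 'S_d | [exists g in 'Gal({:E} / 1)%g,
              [forall k, g (tnth rs k) == tnth rs (s k)]]].

(** Multisets are represented by sequences. *)

(** [s] is the multiset of all deg p roots of p, so p is required to split. *)
Definition root_multiset (R : fieldType) (p : {poly R}) (s : seq R) :=
  p = lead_coef p *: \prod_(c <- s) ('X - c%:P).

Definition iter_multiset (R : fieldType) (f : {poly R}) (n : nat) (s : seq R) :
    seq R :=
  [seq (iter_poly f n).[c] | c <- s].

Definition odd_elts (R : eqType) (s : seq R) : set R :=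
  [set y | odd (count_mem y s)]%classic.

(* Main.v *)
Require Import Defs.
From HB Require Import structures.
From mathcomp Require Import all_boot all_order all_algebra all_fingroup.
From mathcomp Require Import all_solvable all_field.
From mathcomp Require Import boolp classical_sets.
From mathcomp Require filter.

Set Implicit Arguments.
Unset Strict Implicit.
Unset Printing Implicit Defensive.

Import GRing.Theory.

(** Label the vertices of the tree by words over 'I_d, so that a tree automorphism
    becomes its portrait, a permutation in 'S_d attached to each word.  By
    induction on n, the Galois elements fixing level n pointwise induce every
    family of permutations on the fibres above level n:

    - the sign character of level n (the action on the product of the Vandermonde
      roots of the discriminants of f(x) - y, for y in level n) is not a product of
      those of lower levels: otherwise the product of these discriminants,
      which up to constants is the product of the f^(k+1)(c) - t with c in Gamma,
      would be a square in K(t), against the assumption on odd multiplicities;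
    - as the lower levels are full, these sign characters are the only ones
      factoring through level n, so some element fixing level n has odd sign;
    - since d is even, a submodule of F_2^(d^n) stable under the full
      automorphism group and containing an odd vector is everything, so the signs at
      the vertices of level n are independent;
    - a normal subgroup of 'S_d with an odd element is 'S_d, which upgrades
      signs to permutations one vertex at a time.

    The specialization t |-> y embeds the given splitting field of f(x) - t
    above each vertex y, hence the stabilizer of y acts on the fibre of y at
    least as 'Alt_d.  A compactness argument passes from levels to the tree. *)

(** * Normal subgroups of the symmetric group *)

Lemma perm_2transitive (T : finType) (a b x y : T) : a != b -> x != y ->
  exists2 p : {perm T}, p a = x & p b = y.
Proof.
move=> ab xy; exists (tperm a x * tperm (tperm a x b) y)%g.
  rewrite permM tpermL tpermD // 1?eq_sym //.
  by rewrite -{1}(tpermL a x) (inj_eq perm_inj).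
by rewrite permM tpermL.
Qed.

Section NormalSubgroupsOfSym.
Local Open Scope group_scope.
Variables (T : finType) (N : {group {perm T}}).
Hypothesis nN : [set: {perm T}] \subset 'N(N).

Let NJ s p : s \in N -> s ^ p \in N.
Proof. by move=> sN; rewrite memJ_norm // (fintype.subsetP nN) ?inE. Qed.

(** The product is the commutator of [tperm a b] and [s]. It is the source of 3-cycles in [N]
    below. *)
Lemma mul_tpermJ_mem s a b : s \in N -> tperm a b * tperm (s a) (s b) \in N.
Proof.
move=> sN; rewrite -tpermJ /conjg mulgA -{1}[tperm a b]tpermV mulgA groupMr //.
by rewrite -mulgA -/(conjg s^-1 (tperm a b)) NJ // groupV.
Qed.

Lemma all_tperm_full : (forall a b, tperm a b \in N) -> N = [set: {perm T}] :> {set _}.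
Proof.
move=> tN; apply/setP=> s; rewrite inE.
have [ts -> _] := prod_tpermP s.
by apply: group_prod => t _; exact: tN.
Qed.

Lemma tperm_full a b : a != b -> tperm a b \in N -> N = [set: {perm T}] :> {set _}.
Proof.
move=> ab tN; apply: all_tperm_full => x y.
have [->|xy] := eqVneq x y; first by rewrite tperm1 group1.
have [p pa pb] := perm_2transitive ab xy.
by rewrite -pa -pb -tpermJ NJ.
Qed.

(** All 3-cycles are conjugate, hence in [N], and they make any two transpositions congruent modulo
    [N]. A product of an odd number of transpositions is then congruent to a single one. *)
Lemma cycle3_odd_full a b c s : a != b -> b != c -> a != c ->
  tperm a b * tperm b c \in N -> s \in N -> odd_perm s ->
  N = [set: {perm T}] :> {set _}.
Proof.
move=> ab bc ac cN sN so.
have key x y z : x != y -> y != z -> x != z -> tperm x y * tperm y z \in N.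
  move=> xy yz xz.
  have [p [pa pb pc]] : exists p : {perm T}, [/\ p a = x, p b = y & p c = z].
    pose p1 := tperm a x; pose p2 := p1 * tperm (p1 b) y.
    have p1a : p1 a = x by rewrite tpermL.
    have p2b : p2 b = y by rewrite permM tpermL.
    have p2a : p2 a = x.
      rewrite permM p1a tpermD // eq_sym //.
      by rewrite -[x in x != _]p1a (inj_eq perm_inj).
    exists (p2 * tperm (p2 c) z); split; rewrite permM ?tpermL ?p2a ?p2b //.
      rewrite tpermD // eq_sym //.
      by rewrite -[x in x != _]p2a (inj_eq perm_inj).
    rewrite tpermD // eq_sym //.
    by rewrite -[y in y != _]p2b (inj_eq perm_inj).
  by rewrite -pa -pb -pc -!tpermJ -conjMg NJ.
(* Inserting [tperm y z] twice leaves products of transpositions that share a point, which are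
   3-cycles or trivial. *)
have key2 x y z t : x != y -> z != t -> tperm x y * tperm z t \in N.
  have share u v w : u != v -> v != w -> tperm u v * tperm v w \in N.
    move=> uv vw; have [uw|uw] := eqVneq u w; last exact: key.
    by rewrite -uw [tperm v u]tpermC tperm2 group1.
  move=> xy zt; have [yz|yz] := eqVneq y z; first by rewrite yz share // -yz.
  have -> : tperm x y * tperm z t =
      (tperm x y * tperm y z) * (tperm y z * tperm z t).
    by rewrite -!mulgA (mulgA (tperm y z)) tperm2 mul1g.
  by rewrite groupM ?share.
apply: (tperm_full ab).
have [ts Es /allP dts] := prod_tpermP s.
have main (l : seq (T * T)) : {in l, forall t, t.1 != t.2} ->
    let q := \prod_(t <- l) tperm t.1 t.2 in
    if odd (size l) then tperm a b * q \in N else q \in N.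
  elim: l => [|t l IH] dl /=; first by rewrite big_nil group1.
  have t12 : t.1 != t.2 by apply: dl; rewrite mem_head.
  have := IH (fun u ul => dl u (mem_behead (s := t :: l) ul)).
  rewrite /= big_cons; case: (odd (size l)) => /= qN.
    rewrite -[\prod_(_ <- l) _](mulKg (tperm a b)) tpermV.
    by rewrite mulgA groupM // key2.
  by rewrite mulgA groupM // key2.
have := main ts (fun t tl => dts t tl); rewrite /= -Es.
have -> : odd (size ts).
  by move: so; rewrite {1}Es odd_perm_prod //; apply/allP.
by rewrite groupMr.
Qed.

(** Either [s] is a transposition, or commutators with transpositions yield a 3-cycle. The one
    exception, a double transposition on exactly four points, is even. *)
Lemma normal_odd_full s : s \in N -> odd_perm s -> N = [set: {perm T}] :> {set _}.
Proof.
move=> sN so.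
have c3 a b c : a != b -> b != c -> a != c -> tperm a b * tperm b c \in N ->
    N = [set: {perm T}] :> {set _}.
  by move=> ab bc ac abcN; exact: (cycle3_odd_full ab bc ac abcN sN so).
have inv_fix u a e : u \in N -> u a != a -> u e = e ->
    N = [set: {perm T}] :> {set _}.
  move=> uN ua ue; have ae : a != e by apply: contra_neq ua => ->.
  have uae : u a != e by rewrite -[e in _ != e]ue (inj_eq perm_inj).
  apply: (c3 a e (u a)); rewrite // 1?eq_sym //.
  by have := mul_tpermJ_mem a e uN; rewrite ue [tperm (u a) e]tpermC.
have [a sa] : exists a, s a != a.
  apply: contrapT => /forallNP nos; move: so.
  have -> : s = 1 by apply/permP=> x; rewrite perm1; apply/eqP/negPn/negP/nos.
  by rewrite odd_perm1.
(* If the cycle of [a] has length at least 3, the commutator with [tperm a (s a)] is a 3-cycle. *)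
have [ssa|ssa] := eqVneq (s (s a)) a; last first.
  apply: (c3 a (s a) (s (s a))); rewrite 1?eq_sym //.
    by rewrite (inj_eq perm_inj).
  exact: mul_tpermJ_mem.
have [[c [ca cb sc]]|nex] :=
    pselect (exists c, [/\ c != a, c != s a & s c != c]); last first.
  have Es : s = tperm a (s a).
    apply/permP=> x; case: tpermP => [->|->|] // /eqP xa /eqP xb.
    by apply/eqP/negPn/negP => sx; apply: nex; exists x.
  by apply: (@tperm_full a (s a)); rewrite 1?eq_sym // -Es.
have bc : s a != s c by rewrite (inj_eq perm_inj) eq_sym.
have asc : a != s c by rewrite -[a in a != _]ssa (inj_eq perm_inj) eq_sym.
have [ssc|ssc] := eqVneq (s (s c)) c; last first.
  apply: (c3 c (s c) (s (s c))); rewrite 1?eq_sym //.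
    by rewrite (inj_eq perm_inj).
  exact: mul_tpermJ_mem.
have uN := mul_tpermJ_mem a c sN.
set u := _ * _ in uN.
have ua : u a != a.
  by rewrite permM tpermL tpermD // eq_sym.
(* A fifth point is fixed by [u], which moves [a], so [inv_fix] applies. Without one, [s] is a
   product of two transpositions, hence even. *)
have [[e [ea eb ec ed]]|noe] :=
    pselect (exists e, [/\ a != e, s a != e, c != e & s c != e]).
  by apply: (inv_fix u a e) => //; rewrite permM !tpermD.
case/negP: (negbF so); suff -> : s = tperm a (s a) * tperm c (s c).
  by rewrite odd_permM !odd_tperm ![_ == s _]eq_sym sa sc.
apply/permP=> x; rewrite permM.
have [->|xa] := eqVneq x a; first by rewrite tpermL tpermD // eq_sym.
have [->|xb] := eqVneq x (s a); first by rewrite tpermR tpermD // eq_sym.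
rewrite (@tpermD _ a) // 1?eq_sym //.
have [->|xc] := eqVneq x c; first by rewrite tpermL.
have [->|xd] := eqVneq x (s c); first by rewrite tpermR.
by case: noe; exists x; split; rewrite eq_sym.
Qed.
End NormalSubgroupsOfSym.

(** The form in which normality is applied later: in a finite group, closure under products already
    gives inverses. *)
Lemma normal_pred_full (T : finType) (P : {perm T} -> Prop) (s : {perm T}) :
  P 1%g -> (forall p q, P p -> P q -> P (p * q)%g) ->
  (forall p q, P p -> P (p ^ q)%g) -> P s -> odd_perm s -> forall p, P p.
Proof.
move=> P1 PM PJ Ps so p.
have gN : group_set [set q | `[<P q>]].
  by apply/group_setP; split=> [|q r]; rewrite !inE //; exact: PM.
have nN : [set: {perm T}]%SET \subset ('N(Group gN))%g.
  apply/fintype.subsetP=> q _; rewrite inE; apply/fintype.subsetP=> r.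
  by case/imsetP=> r0; rewrite !inE => Pr0 ->; exact: PJ.
have sN : s \in [set q | `[<P q>]] by rewrite !inE.
have /setP/(_ p) := normal_odd_full nN sN so.
by rewrite finset.in_setT /= => /idP; rewrite !inE.
Qed.

(** * Portraits of tree automorphisms *)

Section Portraits.
Variables (d : nat) (G : Type) (one : G) (mul : G -> G -> G) (inv : G -> G).
Variable A : G -> seq 'I_d -> 'S_d.

(** A word is read from the vertex up to the root: its tail is the parent, and its head is the label
    among the children of that parent. *)
Fixpoint word_act g (w : seq 'I_d) : seq 'I_d :=
  if w is k :: w' then A g w' k :: word_act g w' else [::].

(** The group laws are imposed on portraits only, so [G] need not satisfy them as equalities. In
    [mul g h] the factor [h] acts first, while permutations compose from left to right. *)
Hypothesis A_mul : forall g h w, A (mul g h) w = (A h w * A g (word_act h w))%g.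
Hypothesis A_one : forall w, A one w = 1%g.
Hypothesis A_mulV : forall g w, A (mul g (inv g)) w = 1%g.
Hypothesis A_mulVl : forall g w, A (mul (inv g) g) w = 1%g.

Lemma size_word_act g w : size (word_act g w) = size w.
Proof. by elim: w => //= k w ->. Qed.

Lemma word_act_mul g h w : word_act (mul g h) w = word_act g (word_act h w).
Proof. by elim: w => //= k w IH; rewrite IH A_mul permM. Qed.

Lemma word_act_id g w : (forall u, size u < size w -> A g u = 1%g) -> word_act g w = w.
Proof.
elim: w => //= k w IH gw; rewrite IH => [|u uw]; last by rewrite gw // ltnW.
by rewrite gw // perm1.
Qed.

Lemma word_actK g : cancel (word_act g) (word_act (inv g)).
Proof. by move=> w; rewrite -word_act_mul word_act_id // => u _; rewrite A_mulVl. Qed.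

Lemma word_actKV g : cancel (word_act (inv g)) (word_act g).
Proof. by move=> w; rewrite -word_act_mul word_act_id // => u _; rewrite A_mulV. Qed.

Lemma word_act_inj g : injective (word_act g).
Proof. exact: can_inj (word_actK g). Qed.

Lemma A_inv g w : A (inv g) w = (A g (word_act (inv g) w))^-1%g.
Proof. by apply/eqP; rewrite eq_mulgV1 invgK -A_mul A_mulV. Qed.

(** A portrait trivial on the words shorter than [n] fixes all words of length up to [n], so this is
    the pointwise stabilizer of level n. *)
Definition level_stab n g := forall w, size w < n -> A g w = 1%g.

Lemma level_stab_act n g w : level_stab n g -> size w <= n -> word_act g w = w.
Proof. by move=> gn wn; apply: word_act_id => u uw; apply: gn; exact: leq_trans wn. Qed.

Lemma level_stab1 n : level_stab n one.
Proof. by move=> w _; exact: A_one. Qed.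

Lemma level_stabM n g h : level_stab n g -> level_stab n h -> level_stab n (mul g h).
Proof. by move=> gn hn w wn; rewrite A_mul hn // gn ?mulg1 // size_word_act. Qed.

Lemma level_stabV n g : level_stab n g -> level_stab n (inv g).
Proof. by move=> gn w wn; rewrite A_inv gn ?invg1 ?size_word_act. Qed.

Lemma level_A_mul n g h w : level_stab n h -> size w = n ->
  A (mul g h) w = (A h w * A g w)%g.
Proof. by move=> hn wn; rewrite A_mul (level_stab_act hn) // wn. Qed.

Lemma level_A_inv n g w : level_stab n g -> size w = n -> A (inv g) w = (A g w)^-1%g.
Proof.
by move=> gn wn; rewrite A_inv (level_stab_act (level_stabV gn)) // wn.
Qed.

Definition conj_by g h := mul g (mul h (inv g)).

Lemma level_A_conj n g h w : level_stab n h -> size w <= n ->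
  A (conj_by g h) w = (A h (word_act (inv g) w) ^ A g (word_act (inv g) w))%g.
Proof.
move=> hn wn; rewrite !A_mul word_act_mul (level_stab_act hn) ?size_word_act //.
by rewrite A_inv /conjg mulgA.
Qed.

Lemma level_stabJ n g h : level_stab n h -> level_stab n (conj_by g h).
Proof.
move=> hn w wn; rewrite (level_A_conj _ hn) ?(ltnW wn) //.
by rewrite hn ?size_word_act // conj1g.
Qed.

Fixpoint words n : seq (seq 'I_d) :=
  if n is n'.+1 then [seq k :: w | w <- words n', k <- enum 'I_d] else [:: [::]].

Lemma mem_words n w : (w \in words n) = (size w == n).
Proof.
elim: n w => [|n IH] [|k w] //=.
  by apply/negbTE/negP => /allpairsP[[u l] [_ _]].
apply/allpairsP/eqP => [[[u l] /= [un _ [_ ->]]]|[wn]].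
  by apply/eqP; rewrite eqSS -IH.
by exists (w, k); rewrite /= IH wn mem_enum.
Qed.

Lemma uniq_words n : uniq (words n).
Proof.
elim: n => //= n IH; apply: allpairs_uniq => //; first exact: enum_uniq.
by move=> [u l] [u' l'] _ _ /= [-> ->].
Qed.

Lemma perm_act_words n g : perm_eq [seq word_act g w | w <- words n] (words n).
Proof.
apply: uniq_perm; rewrite ?map_inj_uniq ?uniq_words //; first exact: word_act_inj.
move=> w; rewrite mem_words; apply/mapP/eqP => [[u un ->]|wn].
  by rewrite size_word_act; apply/eqP; rewrite -mem_words.
by exists (word_act (inv g) w); rewrite ?word_actKV // mem_words size_word_act wn.
Qed.

(** Vectors of F_2^(d^n) are encoded as boolean functions on all words; only the values at words of
    length [n] matter. *)
Definition parity n (v : seq 'I_d -> bool) := \big[addb/false]_(w <- words n) v w.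

Lemma parity_act n g v : parity n (v \o word_act g) = parity n v.
Proof.
by rewrite /parity -[in RHS](perm_big _ (perm_act_words n g)) big_map.
Qed.

Lemma eq_parity n v v' : (forall w, size w = n -> v w = v' w) ->
  parity n v = parity n v'.
Proof.
move=> vv'; rewrite /parity; apply: eq_big_seq => w.
by rewrite mem_words => /eqP /vv'.
Qed.

Lemma parityD n v v' : parity n (fun w => v w (+) v' w) = parity n v (+) parity n v'.
Proof. exact: big_split. Qed.

Definition level_sgn n g := parity n (fun w => odd_perm (A g w)).

(** The sign is a character of the whole group and not only of a stabilizer, because [h] merely
    permutes the words of level n. *)
Lemma level_sgnM n g h : level_sgn n (mul g h) = level_sgn n g (+) level_sgn n h.
Proof.
rewrite /level_sgn -(parity_act n h (fun w => odd_perm (A g w))) -parityD.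
by apply: eq_parity => w _; rewrite A_mul odd_permM addbC.
Qed.

Lemma level_sgn_stab n h : level_stab n.+1 h -> level_sgn n h = false.
Proof.
move=> hn; rewrite /level_sgn /parity big1_seq // => w /=.
by rewrite mem_words => /eqP wn; rewrite hn ?wn // odd_perm1.
Qed.

Definition supported_at n w p h :=
  level_stab n h /\ forall u, size u = n -> A h u = if u == w then p else 1%g.

Definition full n := forall w p, size w = n -> exists h, supported_at n w p h.

Lemma supported_at1 n w : supported_at n w 1%g one.
Proof. by split; [exact: level_stab1 | move=> u _; rewrite A_one if_same]. Qed.

Lemma supported_atM n w p q g h : supported_at n w p g -> supported_at n w q h ->
  supported_at n w (q * p)%g (mul g h).
Proof.
move=> [gn gA] [hn hA]; split=> [|u un]; first exact: level_stabM.
by rewrite (level_A_mul _ hn un) gA // hA //; case: eqP => _; rewrite ?mulg1.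
Qed.

Lemma supported_atJ n w p g h : size w = n -> supported_at n w p h ->
  supported_at n (word_act g w) (p ^ A g w)%g (conj_by g h).
Proof.
move=> wn [hn hA]; split=> [|u un]; first exact: level_stabJ.
rewrite (level_A_conj _ hn) ?un // hA ?size_word_act //.
rewrite -(inj_eq (@word_act_inj g)) word_actKV.
by case: eqP => [->|]; rewrite ?conj1g // word_actK.
Qed.

(** Elements supported at single vertices are multiplied over the whole level. [Q] records a side
    condition closed under products, such as lying in the kernel of a character. *)
Lemma level_fill (Q : G -> Prop) n (pi : seq 'I_d -> 'S_d) :
  Q one -> (forall g h, Q g -> Q h -> Q (mul g h)) ->
  (forall w p, size w = n -> exists2 h, Q h & supported_at n w p h) ->
  exists h, [/\ Q h, level_stab n h & forall w, size w = n -> A h w = pi w].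
Proof.
move=> Q1 QM Qn.
suff [h [Qh hn hA]] : exists h, [/\ Q h, level_stab n h &
    forall w, size w = n -> A h w = if w \in words n then pi w else 1%g].
  by exists h; split=> // w wn; rewrite hA // mem_words wn eqxx.
have: all (fun w => size w == n) (words n) by apply/allP=> w; rewrite mem_words.
elim: (words n) (uniq_words n) => [|w l IH] /=.
  by exists one; split=> //; exact: level_stab1.
case/andP=> wl ul /andP[/eqP wn ln]; have [h [Qh hn hA]] := IH ul ln.
have [g Qg [gn gA]] := Qn w (pi w) wn.
exists (mul g h); split; [exact: QM|exact: level_stabM|move=> u un].
rewrite (level_A_mul _ hn un) hA // gA // inE.
by have [->|] := eqVneq u w; rewrite /= ?(negPf wl) ?mul1g ?mulg1.
Qed.

(** * Transitivity, and characters that factor through a level *)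

Hypothesis d_gt1 : 1 < d.
Let k0 : 'I_d := Ordinal (ltnW d_gt1).
Let k1 : 'I_d := Ordinal d_gt1.

Lemma full_transitive n w w' : (forall k, k < n -> full k) ->
  size w = n -> size w' = n -> exists g, word_act g w = w'.
Proof.
elim: n w w' => [|n IH] w w' Fn.
  by move=> /size0nil-> /size0nil->; exists one.
case: w => [|k w] //= [wn]; case: w' => [|k' w'] //= [w'n].
have [|g gw] := IH w w' _ wn w'n; first by move=> m mn; apply: Fn; exact: ltnW.
have [h [hn hA]] := Fn n (ltnSn n) w' (tperm (A g w k) k') w'n.
exists (mul h g); rewrite /= word_act_mul A_mul permM gw hA // eqxx tpermL.
by rewrite (level_stab_act hn) ?w'n.
Qed.

Lemma full_transitive2 n w w' k l k' l' : (forall m, m <= n -> full m) ->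
  size w = n -> size w' = n -> k != l -> k' != l' ->
  exists g, word_act g (k :: w) = k' :: w' /\ word_act g (l :: w) = l' :: w'.
Proof.
move=> Fn wn w'n kl kl'.
have [|g gw] := full_transitive _ wn w'n; first by move=> m /ltnW; exact: Fn.
have gkl : A g w k != A g w l by rewrite (inj_eq perm_inj).
have [p pk pl] := perm_2transitive gkl kl'.
have [h [hn hA]] := Fn n (leqnn n) w' p w'n.
exists (mul h g); rewrite /= word_act_mul A_mul !permM gw hA // eqxx pk pl.
by rewrite (level_stab_act hn) ?w'n.
Qed.

(* Modulo a power of [level_sgn n], [chi] kills one odd element supported at a
   single vertex of level n; the elements supported there and killed by [chi]
   form a normal subgroup of 'S_d, hence everything. *)
Lemma level_character n (chi : G -> bool) :
  (forall k, k < n -> full k) ->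
  (forall g h, chi (mul g h) = chi g (+) chi h) ->
  (forall h, level_stab n h -> chi h = false) ->
  exists b : nat -> bool,
    forall g, chi g = \big[addb/false]_(k < n) (b k && level_sgn k g).
Proof.
elim: n chi => [|n IH] chi Fn chiM chin.
  by exists (fun=> false) => g; rewrite big_ord0 chin.
have n1 : full n by exact: Fn.
pose w0 := nseq n k0.
have w0n : size w0 = n by rewrite size_nseq.
have [h0 h0w] := n1 w0 (tperm k0 k1) w0n.
pose chi' g := chi g (+) (chi h0 && level_sgn n g).
have chi'M g h : chi' (mul g h) = chi' g (+) chi' h.
  rewrite /chi' chiM level_sgnM.
  by case: (chi g) (chi h) (chi h0) (level_sgn n g) (level_sgn n h)
    => [] [] [] [] [].
have chi'n h : level_stab n.+1 h -> chi' h = false.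
  by move=> hn; rewrite /chi' chin // level_sgn_stab // andbF.
have chi'1 : chi' one = false by apply: chi'n; exact: level_stab1.
have chi'J g h : chi' (conj_by g h) = chi' h.
  rewrite /conj_by !chi'M; have: chi' (mul g (inv g)) = false.
    by apply: chi'n => w _; rewrite A_mulV.
  by rewrite chi'M; case: (chi' g) (chi' h) (chi' (inv g)) => [] [] [].
have chi'h0 : chi' h0 = false.
  suff h0n : level_sgn n h0 by rewrite /chi' h0n andbT addbb.
  rewrite /level_sgn /parity (bigD1_seq w0) ?uniq_words ?mem_words ?w0n //=.
  rewrite (proj2 h0w) // eqxx odd_tperm big1_seq // => w /andP[ww0].
  by rewrite mem_words => /eqP wn; rewrite (proj2 h0w) // (negPf ww0) odd_perm1.
have chi'f w p : size w = n -> exists2 h, chi' h = false & supported_at n w p h.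
  move=> wn; have [|g gw] := full_transitive _ w0n wn.
    by move=> k kn; apply: Fn; exact: ltnW.
  apply: (@normal_pred_full _
    (fun p => exists2 h, chi' h = false & supported_at n w p h)
    (tperm k0 k1 ^ A g w0)%g) => [|q r [h ch hq] [h' ch' hr]|q r [h ch hq]||].
  - by exists one; [|exact: supported_at1].
  - exists (mul h' h); first by rewrite chi'M ch ch'.
    exact: supported_atM.
  - have [h' h'r] := n1 w r wn; exists (conj_by h' h); first by rewrite chi'J.
    have := supported_atJ h' wn hq.
    rewrite (proj2 h'r) // eqxx (level_stab_act (proj1 h'r)) ?wn //.
  - exists (conj_by g h0); first by rewrite chi'J.
    by rewrite -gw; exact: supported_atJ.
  - by rewrite odd_permJ odd_tperm.
have [||b chib] := IH chi' _ chi'M.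
- by move=> k kn; apply: Fn; exact: ltnW.
(* [chi'] vanishes on the stabilizer of level n: [h] agrees on level n with some [h'] in the kernel
   of [chi'], and their quotient fixes level n+1. *)
- move=> h hn.
  have [||h' [ch' h'n h'A]] := @level_fill (fun h => chi' h = false) n (A h) chi'1.
  + by move=> x y xc yc; rewrite chi'M xc yc.
  + exact: chi'f.
  have : chi' (mul (inv h') h) = false.
    apply: chi'n => u; rewrite ltnS leq_eqVlt => /orP[/eqP un|un].
      rewrite (level_A_mul _ hn un) (level_A_inv h'n un) h'A //.
      by rewrite mulgV.
    by rewrite (level_stabM (level_stabV h'n) hn).
  rewrite chi'M; have: chi' (mul (inv h') h') = false.
    by apply: chi'n => u _; rewrite A_mulVl.
  by rewrite chi'M ch' addbF => ->; rewrite addFb.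
exists (fun k => if k == n then chi h0 else b k) => g.
rewrite big_ord_recr /= eqxx.
under eq_bigr => k _ do rewrite (ltn_eqF (ltn_ord k)).
by rewrite -chib /chi' -addbA addbb addbF.
Qed.

(** * Submodules of the permutation module of a level over F_2 *)

Hypothesis d_even : ~~ odd d.

Definition block_sum (v : seq 'I_d -> bool) w := \big[addb/false]_k v (k :: w).

Lemma parity_block n v : parity n.+1 v = parity n (block_sum v).
Proof.
rewrite /parity /= big_allpairs_dep; apply: eq_bigr => w _.
by rewrite big_enum.
Qed.

Lemma block_sumD v v' w :
  block_sum (fun u => v u (+) v' u) w = block_sum v w (+) block_sum v' w.
Proof. exact: big_split. Qed.

Lemma block_sum_act g v w : block_sum (v \o word_act g) w = block_sum v (word_act g w).
Proof. by rewrite /block_sum [RHS](reindex_inj (@perm_inj _ (A g w))). Qed.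

Lemma block_sum_pred1 k w u :
  block_sum (fun x => x == k :: w) u = (u == w).
Proof.
rewrite /block_sum (bigD1 k) //= eqseq_cons eqxx big1 ?addbF // => l lk.
by rewrite eqseq_cons (negPf lk).
Qed.

(** As [d] is even, a vector that is constant on a fibre has sum zero there. *)
Lemma block_sum_odd v w : block_sum v w ->
  exists k l, [/\ k != l, v (k :: w) & ~~ v (l :: w)].
Proof.
move=> vw; have [k vk] : exists k, v (k :: w).
  apply: contrapT => /forallNP nv; move: vw.
  by rewrite /block_sum big1 // => k _; apply/negbTE/negP/nv.
have [l vl] : exists l, ~~ v (l :: w).
  apply: contrapT => /forallNP nv; move: vw; rewrite /block_sum.
  under eq_bigr => l _ do [have /negP/negPn -> := nv l].
  rewrite big_const_ord; have -> m : iter m (addb true) false = odd m.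
    by elim: m => //= m ->.
  exact/negP.
by exists k, l; split=> //; apply: contraNneq vl => <-.
Qed.

(* The permutation module F_2^(d^n) of the tree has a unique maximal submodule,
   that of the vectors of even parity; this is where d even is needed. *)
Lemma odd_submodule_full n (V : (seq 'I_d -> bool) -> Prop) v0 :
  (forall k, k < n -> full k) ->
  (forall v v', (forall w, size w = n -> v w = v' w) -> V v -> V v') ->
  (forall v v', V v -> V v' -> V (fun w => v w (+) v' w)) ->
  (forall g v, V v -> V (v \o word_act g)) ->
  V v0 -> parity n v0 ->
  forall w, size w = n -> V (fun u => u == w).
Proof.
elim: n V v0 => [|n IH] V v0 Fn Vext VD Vact Vv0 v0odd w wn.
  apply: Vext Vv0 => u /size0nil->; rewrite (size0nil wn) eqxx.
  by move: v0odd; rewrite /parity /= big_seq1.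
have Fn' m : m < n -> full m by move=> /ltnW; exact: Fn.
have V0 : V (fun=> false).
  by apply: Vext (VD _ _ Vv0 Vv0) => u _; rewrite addbb.
have Vsum (I : eqType) (s : seq I) (v : I -> seq 'I_d -> bool) :
    {in s, forall x, V (v x)} -> V (fun u => \big[addb/false]_(x <- s) v x u).
  elim: s => [|x s IHs] Vs.
    by apply: Vext V0 => u _; rewrite big_nil.
  apply: Vext (VD _ _ (Vs x (mem_head _ _)) (IHs _)) => [u _|y ys].
    by rewrite big_cons.
  by apply: Vs; rewrite inE ys orbT.
have [w0 w0n vw0] : exists2 w0, size w0 = n & block_sum v0 w0.
  move: v0odd; rewrite parity_block => v0odd; apply: contrapT => nw.
  move: v0odd; rewrite /parity big1_seq // => u /=; rewrite mem_words => /eqP un.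
  by apply/negbTE/negP => vu; apply: nw; exists u.
have [k [l [kl vk vl]]] := block_sum_odd vw0.
(* Adding to [v0] its translate by an element that only swaps [k] and [l] over [w0] leaves exactly
   these two words. *)
have Vkl : V (fun u => (u == k :: w0) (+) (u == l :: w0)).
  have [h [hn hA]] := Fn n (ltnSn n) w0 (tperm k l) w0n.
  apply: Vext (VD _ _ Vv0 (Vact h _ Vv0)) => [[|j u] //= [un]].
  rewrite (level_stab_act hn) ?un // hA // !eqseq_cons.
  have [->|] := eqVneq u w0; last by rewrite perm1 addbb !andbF.
  by rewrite !andbT; case: tpermP => [->|->|/eqP jk /eqP jl];
    rewrite ?vk ?(negPf vl) ?eqxx ?(negPf kl) // ?(negPf jk) ?(negPf jl) ?addbb
      // eq_sym (negPf kl).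
have Vsib u j m : size u = n -> V (fun x => (x == j :: u) (+) (x == m :: u)).
  move=> un; have [->|jm] := eqVneq j m.
    by apply: Vext V0 => x _; rewrite addbb.
  have [//|g [gj gm]] := full_transitive2 _ un w0n jm kl.
  apply: Vext (Vact g _ Vkl) => x _ /=.
  by rewrite -gj -gm !(inj_eq (@word_act_inj g)).
(* Sibling pairs span the kernel of [block_sum]: over each [u], every word of the support is paired
   with [k0 :: u], and the copies of [k0 :: u] cancel since their number is even. *)
have Vblock v : (forall u, size u = n -> block_sum v u = false) -> V v.
  move=> vB.
  have VS u : size u = n -> V (fun x => (behead x == u) && v x).
    move=> un.
    have : V (fun x => \big[addb/false]_(j <- enum 'I_d)
        (v (j :: u) && ((x == j :: u) (+) (x == k0 :: u)))).
      apply: (Vsum _ _ (fun j x => v (j :: u) && ((x == j :: u) (+) (x == k0 :: u)))).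
      move=> j _; case: (v (j :: u)) => /=; first exact: Vsib.
      exact: V0.
    apply: Vext => [[|j x]] //= _; rewrite big_enum /=.
    under eq_bigr => m _ do rewrite andb_addr !eqseq_cons.
    rewrite big_split /= -big_distrl /= -/(block_sum v u) vB // addbF.
    have [->|xu] := eqVneq x u; last by rewrite big1 // => m _; rewrite !andbF.
    rewrite (bigD1 j) //= eqxx !andbT big1 ?addbF // => m mj.
    by rewrite andbT eq_sym (negPf mj) andbF.
  apply: Vext (Vsum _ (words n) (fun u x => (behead x == u) && v x) _).
    move=> [|j x] //= [xn]; rewrite (bigD1_seq x) ?uniq_words ?mem_words ?xn //=.
    rewrite eqxx big1 ?addbF // => u ux.
    by rewrite eq_sym (negPf ux).
  by move=> u; rewrite mem_words => /eqP; exact: VS.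
case: w wn => [|j w] //= [wn].
(* The image of [V] under [block_sum] is a submodule one level down, to which induction applies. The
   lift of the unit vector at [w] differs from the desired unit vector by an element of the
   kernel. *)
pose Vb u := exists2 v, V v & forall x, size x = n -> u x = block_sum v x.
have [||||||v Vv vw] := IH Vb (block_sum v0) _ _ _ _ _ _ w wn => //.
- by move=> u u' uu' [v Vv vu]; exists v => // x xn; rewrite -uu' // vu.
- move=> u u' [v Vv vu] [v' Vv' vu'].
  exists (fun x => v x (+) v' x); first exact: VD.
  by move=> x xn; rewrite block_sumD vu // vu'.
- move=> g u [v Vv vu]; exists (v \o word_act g); first exact: Vact.
  by move=> x xn; rewrite /= block_sum_act vu // size_word_act.
- by exists v0.
- by rewrite -parity_block.
have Vd : V (fun x => v x (+) (x == j :: w)).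
  by apply: Vblock => u un; rewrite block_sumD block_sum_pred1 -vw // addbb.
by apply: Vext (VD _ _ Vv Vd) => x _; rewrite addbA addbb.
Qed.

(** * Induction on levels: all permutations above a vertex *)

Hypothesis alt_stab : forall w p, ~~ odd_perm p ->
  exists2 g, word_act g w = w & A g w = p.
Hypothesis level_sgn_indep : forall n (b : nat -> bool),
  ~ (forall g, level_sgn n g = \big[addb/false]_(k < n) (b k && level_sgn k g)).

Section FullStep.
Variable n : nat.
Hypothesis full_lt : forall k, k < n -> full k.

(** Otherwise the sign of level n would be trivial on the stabilizer of level n, hence a combination
    of lower signs by [level_character], against their independence. *)
Lemma level_stab_sgn : exists2 h, level_stab n h & level_sgn n h.
Proof.
apply: contrapT => nex.
have [|b] := level_character full_lt (level_sgnM n).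
- by move=> h hn; apply/negbTE/negP => sh; apply: nex; exists h.
- exact: level_sgn_indep.
Qed.

(** The sign vectors of the elements fixing level n form a stable submodule, and [level_stab_sgn]
    provides an odd vector in it. *)
Lemma level_odd_at w : size w = n -> exists2 h, level_stab n h &
  forall u, size u = n -> odd_perm (A h u) = (u == w).
Proof.
have [h0 h0n sh0] := level_stab_sgn.
pose V v := exists2 h, level_stab n h & forall u, size u = n -> odd_perm (A h u) = v u.
apply: (@odd_submodule_full n V (fun u => odd_perm (A h0 u))) => //.
- by move=> v v' vv' [h hn hv]; exists h => // u un; rewrite -vv' // hv.
- move=> v v' [h hn hv] [h' hn' hv']; exists (mul h' h); first exact: level_stabM.
  by move=> u un; rewrite (level_A_mul _ hn un) odd_permM hv // hv'.
- move=> g v [h hn hv]; exists (conj_by (inv g) h); first exact: level_stabJ.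
  move=> u un; rewrite (level_A_conj _ hn) ?un // odd_permJ hv ?size_word_act //=.
  congr (v _); apply: (@word_act_inj (inv g)); rewrite word_actKV word_actK //.
- by exists h0.
Qed.

Lemma stab_A_full w p : size w = n -> exists2 g, word_act g w = w & A g w = p.
Proof.
move=> wn; have [pe|po] := boolP (odd_perm p); last exact: alt_stab.
have [h hn hw] := level_odd_at wn.
have [|g gw gA] := @alt_stab w ((A h w)^-1 * p)%g.
  by rewrite odd_permM odd_permV hw // eqxx pe.
have hw' : word_act h w = w by rewrite (level_stab_act hn) ?wn.
exists (mul g h); first by rewrite word_act_mul hw' gw.
by rewrite A_mul hw' gA mulKVg.
Qed.

(** The permutations induced at [w] by elements fixing level n are normalized by those of the whole
    stabilizer of [w], which is all of ['S_d] by [stab_A_full]; one of them is odd. *)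
Lemma level_A_full w p : size w = n -> exists2 h, level_stab n h & A h w = p.
Proof.
move=> wn; have [h0 h0n h0w] := level_odd_at wn.
apply: (@normal_pred_full _ (fun p => exists2 h, level_stab n h & A h w = p)
  (A h0 w)) => [|q r [h hn hq] [h' hn' hr]|q r [h hn hq]||].
- by exists one; [exact: level_stab1 | exact: A_one].
- exists (mul h' h); first exact: level_stabM.
  by rewrite (level_A_mul _ hn wn) hq hr.
- have [g gw gA] := stab_A_full r wn.
  exists (conj_by g h); first exact: level_stabJ.
  have gVw : word_act (inv g) w = w by apply: (@word_act_inj g); rewrite word_actKV.
  by rewrite (level_A_conj _ hn) ?wn // gVw hq gA.
- by exists h0.
- by rewrite h0w // eqxx.
Qed.

(* Each new vertex [c] of the list is made trivial by dividing by an element with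
   the same permutation at [c], even permutations elsewhere, and trivial on the
   rest of the list. *)
Lemma odd_at_trivial_on (l : seq (seq 'I_d)) w : size w = n -> w \notin l ->
  exists h, [/\ level_stab n h, forall u, u \in l -> size u = n -> A h u = 1%g &
    forall u, size u = n -> odd_perm (A h u) = (u == w)].
Proof.
elim: l w => [|c l IH] w wn.
  by have [h hn hw] := level_odd_at wn; exists h; split.
rewrite inE negb_or => /andP[wc wl]; have [h [hn hl hw]] := IH w wn wl.
have [cl|cl] := boolP (c \in l).
  exists h; split=> // u; rewrite inE => /orP[/eqP->|]; exact: hl.
have [cn|cn] := eqVneq (size c) n; last first.
  exists h; split=> // u; rewrite inE => /orP[/eqP->|]; last exact: hl.
  by move/eqP; rewrite (negPf cn).
have [h0 [h0n h0l h0c]] := IH c cn cl.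
(* The permutations at [c] obtained under these constraints form a normal subgroup of ['S_d], in
   which [h0] provides an odd element. *)
have [q [qn ql qe qc]] : exists q, [/\ level_stab n q,
    forall u, u \in l -> size u = n -> A q u = 1%g,
    forall u, size u = n -> u != c -> ~~ odd_perm (A q u) & A q c = A h c].
  apply: (@normal_pred_full _ (fun p => exists q, [/\ level_stab n q,
    forall u, u \in l -> size u = n -> A q u = 1%g,
    forall u, size u = n -> u != c -> ~~ odd_perm (A q u) & A q c = p])
    (A h0 c)) => [|p r [g [gn gl ge gc]] [g' [g'n g'l g'e g'c]]
                  |p r [g [gn gl ge gc]]||].
  - by exists one; split=> *; rewrite ?A_one ?odd_perm1 //; exact: level_stab1.
  - exists (mul g' g); split; first exact: level_stabM.
    + by move=> u ul un; rewrite (level_A_mul _ gn un) gl // g'l // mulg1.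
    + move=> u un uc; rewrite (level_A_mul _ gn un) odd_permM.
      by rewrite (negPf (ge _ _ _)) // (negPf (g'e _ _ _)).
    + by rewrite (level_A_mul _ gn cn) gc g'c.
  - have [g' g'n g'c] := level_A_full r cn.
    have fixV u : size u = n -> word_act (inv g') u = u.
      by move=> un; rewrite (level_stab_act (level_stabV g'n)) ?un.
    exists (conj_by g' g); split; first exact: level_stabJ.
    + by move=> u ul un; rewrite (level_A_conj _ gn) ?un // fixV // gl // conj1g.
    + by move=> u un uc; rewrite (level_A_conj _ gn) ?un // fixV // odd_permJ ge.
    + by rewrite (level_A_conj _ gn) ?cn // fixV // gc g'c.
  - by exists h0; split=> // u un uc; rewrite h0c.
  - by rewrite h0c // eqxx.
exists (mul (inv q) h); split.
- exact: level_stabM (level_stabV qn) hn.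
- move=> u; rewrite inE => /orP[/eqP-> _|ul un].
    by rewrite (level_A_mul _ hn cn) (level_A_inv qn cn) qc mulgV.
  by rewrite (level_A_mul _ hn un) (level_A_inv qn un) ql // hl // invg1 mulg1.
- move=> u un; rewrite (level_A_mul _ hn un) (level_A_inv qn un).
  rewrite odd_permM odd_permV hw //; have [->|uc] := eqVneq u c.
    by rewrite qc hw // eq_sym (negPf wc).
  by rewrite (negPf (qe _ _ _)) // addbF.
Qed.

(** [odd_at_trivial_on], applied to the list of all other vertices of the level, gives an odd
    permutation supported at [w] alone; its normal closure is ['S_d]. *)
Lemma full_step : full n.
Proof.
move=> w p wn.
have [||h [hn hl hw]] := @odd_at_trivial_on (rem w (words n)) w => //.
  by rewrite mem_rem_uniq ?uniq_words // inE eqxx.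
apply: (@normal_pred_full _ (fun p => exists h, supported_at n w p h) (A h w))
  => [|q r [g gq] [g' gr]|q r [g gq]||].
- by exists one; exact: supported_at1.
- by exists (mul g' g); exact: supported_atM.
- have [g' g'w g'r] := stab_A_full r wn.
  by exists (conj_by g' g); rewrite -{1}g'w -g'r; exact: supported_atJ.
- exists h; split=> // u un; have [->//|uw] := eqVneq u w.
  by rewrite hl // mem_rem_uniq ?uniq_words // inE uw mem_words un eqxx.
- by rewrite hw // eqxx.
Qed.

End FullStep.

Lemma full_all n : full n.
Proof.
have [m] := ubnP n; elim: m n => // m IH n nm; apply: full_step => k kn.
by apply: IH; exact: leq_trans kn nm.
Qed.

Theorem portrait_approx (pi : seq 'I_d -> 'S_d) n :
  exists g, forall w, size w < n -> A g w = pi w.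
Proof.
elim: n => [|n [g gpi]]; first by exists one.
(* The correction acts after [g], so its value at a word is prescribed through the preimage of that
   word under [g]. *)
have [||h [_ hn hA]] := @level_fill (fun=> True) n
    (fun w => (A g (word_act (inv g) w))^-1 * pi (word_act (inv g) w))%g I => //.
  by move=> w p wn; have [h hw] := full_all p wn; exists h.
exists (mul h g) => w; rewrite ltnS leq_eqVlt => /orP[/eqP wn|wn].
  by rewrite A_mul hA ?size_word_act // word_actK mulKVg.
by rewrite A_mul hn ?size_word_act // mulg1 gpi.
Qed.

End Portraits.

Local Open Scope ring_scope.

(** * Embeddings into separably closed fields *)

(** The final segments of a directed preorder generate a proper filter. An ultrafilter refining it
    is the form that compactness takes below. *)
Lemma directed_ultrafilter (T : Type) (t0 : T) (le : T -> T -> Prop) :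
  (forall t, le t t) -> (forall x y z, le x y -> le y z -> le x z) ->
  (forall x y, exists2 z, le x z & le y z) ->
  exists2 U : set (set T), filter.UltraFilter U &
    forall t (B : set T), (forall u, le t u -> B u) -> U B.
Proof.
move=> le_refl le_trans le_dir.
pose F : set (set T) := [set B | exists t, forall u, le t u -> B u]%classic.
have FF : filter.ProperFilter F.
  apply: filter.Build_ProperFilter_ex => [B [t tB]|]; first by exists t; exact: tB.
  split=> [|B C [x xB] [y yC]|B C BC [x xB]].
  - by exists t0.
  - have [z xz yz] := le_dir x y; exists z => u zu.
    by split; [apply: xB; apply: le_trans zu|apply: yC; apply: le_trans zu].
  - by exists x => u /xB /BC.
have [U [UU FU]] := filter.ultraFilterLemma FF.
by exists U => // t B tB; apply: FU; exists t.
Qed.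

(** * Ultralimits of maps and of field morphisms *)

Section Ultralimits.
Import filter.
Variables (T : Type) (U : set (set T)).
Hypothesis UU : UltraFilter U.
Let UF : ProperFilter U := ultra_proper.

(** An ultrafilter that confines a value to a finite list selects one entry of the list. *)
Lemma ultra_limit (N : Type) (M : eqType) (phi : T -> N -> M) :
  (forall x, exists l : seq M, U [set t | phi t x \in l]%classic) ->
  exists psi : N -> M, forall x, U [set t | phi t x = psi x]%classic.
Proof.
move=> phil; suff /boolp.choice[psi psiP] :
    forall x, exists y, U [set t | phi t x = y]%classic.
  by exists psi.
move=> x.
have [l] := phil x; elim: l => [|y l IH] Ul.
  have := @filter_not_empty _ U _; case.
  by apply: filterS Ul => t.
have [Uy|Uy] := in_ultra_setVsetC [set t | phi t x = y]%classic UU.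
  by exists y.
apply: IH; apply: filterS2 Ul Uy => t /=.
by rewrite inE => /orP[/eqP|].
Qed.

Lemma ultra_const (P : Prop) : U [set _ | P]%classic -> P.
Proof.
move=> UP; apply: contrapT => nP; have := @filter_not_empty _ U _; case.
by apply: filterS UP.
Qed.

(** Each identity is required on a set of [U] only, so the single [phi t] may be morphisms on a part
    of [N]. *)
Lemma ultra_rmorphism (N M : fieldType) (phi : T -> N -> M) :
  (forall x, exists l : seq M, U [set t | phi t x \in l]%classic) ->
  (forall x y, U [set t | phi t (x - y) = phi t x - phi t y]%classic) ->
  (forall x y, U [set t | phi t (x * y) = phi t x * phi t y]%classic) ->
  U [set t | phi t 1 = 1]%classic ->
  exists psi : {rmorphism N -> M}, forall x, U [set t | phi t x = psi x]%classic.
Proof.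
move=> phil phiB phiM phi1; have [psi psiP] := ultra_limit phil.
have psiB : zmod_morphism psi.
  move=> x y; apply: ultra_const.
  apply: filterS (filterI (filterI (psiP x) (psiP y))
                          (filterI (psiP (x - y)) (phiB x y))).
  by move=> t /= [[<- <-] [<-]].
have psiM : monoid_morphism psi.
  split=> [|x y]; apply: ultra_const.
    by apply: filterS (filterI (psiP 1) phi1) => t /= [<-].
  apply: filterS (filterI (filterI (psiP x) (psiP y))
                          (filterI (psiP (x * y)) (phiM x y))).
  by move=> t /= [[<- <-] [<-]].
pose p : {rmorphism N -> M} := HB.pack psi
  (GRing.isZmodMorphism.Build N M psi psiB)
  (GRing.isMonoidMorphism.Build N M psi psiM).
by exists p.
Qed.

End Ultralimits.

Lemma finite_roots (M : fieldType) (p : {poly M}) : p != 0 ->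
  exists l : seq M, forall x, root p x -> x \in l.
Proof.
have [n] := ubnP (size p); elim: n p => // n IH p pn p0.
have [[x px]|nox] := pselect (exists x, root p x); last first.
  by exists [::] => x px; case: nox; exists x.
have /factor_theorem[q Dp] := px.
have q0 : q != 0 by apply: contraNneq p0 => q0; rewrite Dp q0 mul0r.
have [|//|l lq] := IH q.
  by move: pn; rewrite Dp size_Mmonic ?monicXsubC // size_XsubC addn2.
exists (x :: l) => y; rewrite Dp rootM root_XsubC inE => /orP[/lq->|->//].
by rewrite orbT.
Qed.

Lemma separably_closed_roots (M : fieldType) (p : {poly M}) :
  separably_closed M -> separable_poly p ->
  exists rs : seq M, [/\ uniq rs, size rs = (size p).-1 & all (root p) rs].
Proof.
move=> Msc; have [n] := ubnP (size p); elim: n p => // n IH p pn psep.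
have [p1|p1] := leqP (size p) 1.
  by exists [::]; split=> //; case: (size p) p1 => [|[]].
have [x px] := Msc p psep p1.
have /factor_theorem[q Dp] := px.
move: (psep); rewrite Dp separable_root => /andP[qsep qx].
have q0 := separable_poly_neq0 qsep.
have sq : size p = (size q).+1.
  by rewrite Dp size_Mmonic ?monicXsubC // size_XsubC addn2.
have [|//|rs [urs srs ars]] := IH q; first by rewrite -ltnS -sq.
exists (x :: rs); split=> /=.
- by rewrite urs andbT; apply: contra qx => /(allP ars).
- by rewrite srs -Dp sq /= prednK // size_poly_gt0.
- rewrite rootM root_XsubC eqxx orbT; apply/allP=> y /(allP ars) qy.
  by rewrite rootM qy.
Qed.

Definition infinite_field (k : fieldType) :=
  forall n, exists2 s : seq k, uniq s & size s = n.

(** * Extending embeddings along separable algebraic extensions *)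

Section SeparableEmbedding.
Variables (k N M : fieldType) (c : {rmorphism k -> N}) (a : {rmorphism k -> M}).
Hypothesis N_sep : forall x : N, exists2 q, separable_poly q & root (map_poly c q) x.
Hypothesis M_closed : separably_closed M.
Hypothesis k_inf : infinite_field k.

(** The primitive element theorem, applied to one more element at a time. *)
Lemma common_generator (S : seq N) :
  exists u, forall x, x \in S -> exists h, (map_poly c h).[u] = x.
Proof.
elim: S => [|x S [u uS]]; first by exists 0.
have [p psep px] := N_sep x; have [q qsep qu] := N_sep u.
have [r r0 PET] := large_field_PET (separable_poly_neq0 psep) px qu qsep.
(* [r] has fewer than [size r] roots, so one of these elements of [k] is a suitable multiplier. *)
have [s us ss] := k_inf (size r).
have [t _ rt] : exists2 t, t \in s & ~~ root r (c t).
  apply: contrapT => nex.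
  suff: (size (map c s) < size r)%N by rewrite size_map ss ltnn.
  apply: max_poly_roots => //; last by rewrite map_inj_uniq //; exact: fmorph_inj.
  apply/allP=> y /mapP[t ts ->]; apply/negPn/negP => rt.
  by apply: nex; exists t.
have [[hx xE] [hu uE]] := PET t rt; exists (c t * u - x) => y.
rewrite inE => /orP[/eqP->|/uS[h <-]]; first by exists hx.
by exists (h \Po hu); rewrite map_comp_poly horner_comp uE.
Qed.

(** [p] is a nonzero annihilator of least size, that is a minimal polynomial of [u]; it is separable
    as a divisor of a separable polynomial. *)
Lemma minimal_annihilator u : exists p, [/\ separable_poly p, (1 < size p)%N &
  forall h, ((map_poly c h).[u] == 0) = (p %| h)].
Proof.
have [q qsep qu] := N_sep u.
pose P n := `[< exists p : {poly k}, [/\ p != 0, root (map_poly c p) u & size p = n] >].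
have exP : exists n, P n.
  exists (size q); apply/asboolP; exists q; split=> //.
  exact: separable_poly_neq0.
case: (ex_minnP exP) => n /asboolP[p [p0 pu pn]] nmin.
have pdvd h : ((map_poly c h).[u] == 0) = (p %| h).
  apply/eqP/idP => [hu|/dvdpP[g ->]]; last first.
    by rewrite rmorphM hornerM (rootP pu) mulr0.
  apply/negPn/negP => ph; have: (n <= size (h %% p)%R)%N.
    apply: nmin; apply/asboolP; exists (h %% p)%R; split=> //.
    rewrite /root -{1}[h %% p](addKr (h %/ p * p)) -divp_eq rmorphD rmorphN.
    by rewrite rmorphM /= !hornerE hu (rootP pu) mulr0 oppr0 addr0.
  by rewrite leqNgt -pn ltn_modp p0.
exists p; split=> //.
  by apply: dvdp_separable qsep; rewrite -pdvd -/(root _ _).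
rewrite ltnNge; apply: contra p0 => /size1_polyC pE.
by move: pu; rewrite pE map_polyC rootC fmorph_eq0 polyC_eq0.
Qed.

(* If every conjugate [w] of [u] gave [h(w) = y], then [h - y], reduced modulo
   the minimal polynomial of [u], would have too many roots. *)
Lemma lift_generator u h y :
  exists w, (forall g, (map_poly c g).[u] = 0 -> (map_poly a g).[w] = 0) /\
    ((forall e, c e <> (map_poly c h).[u]) -> (map_poly a h).[w] <> y).
Proof.
have [p [psep p1 pP]] := minimal_annihilator u.
have pasep : separable_poly (map_poly a p) by rewrite separable_map.
have [rs [urs srs ars]] := separably_closed_roots M_closed pasep.
have wP w : root (map_poly a p) w -> forall g, (map_poly c g).[u] = 0 ->
    (map_poly a g).[w] = 0.
  move=> pw g /eqP; rewrite pP => /dvdpP[r ->].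
  by rewrite rmorphM hornerM (rootP pw) mulr0.
have [hk|nhk] := pselect (forall e, c e <> (map_poly c h).[u]); last first.
  have [|w pw] := M_closed pasep; first by rewrite size_map_poly.
  by exists w; split=> [|/nhk//]; exact: wP.
apply: contrapT => nex.
have hm z : (map_poly c h).[z] = (map_poly c (h %/ p)).[z] * (map_poly c p).[z] +
    (map_poly c (h %% p)).[z].
  by rewrite {1}(divp_eq h p) rmorphD rmorphM hornerD hornerM.
pose r := map_poly a (h %% p) - y%:P.
have r0 : r = 0.
  apply: contrapT => /eqP r0; have: (size rs < size r)%N.
    apply: max_poly_roots => //; apply/allP=> w /(allP ars) pw.
    have hw : (map_poly a h).[w] = y.
      apply: contrapT => hw; apply: nex; exists w; split=> //; exact: wP.
    rewrite /root hornerD hornerN hornerC subr_eq0 -hw eq_sym {1}(divp_eq h p).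
    by rewrite rmorphD rmorphM hornerD hornerM (rootP pw) mulr0 add0r.
  rewrite srs size_map_poly ltnNge => /negP; apply.
  rewrite (leq_trans (size_polyD _ _)) // geq_max size_map_poly.
  rewrite -ltnS prednK ?(ltnW p1) // ltn_modp -size_poly_gt0 (ltnW p1) /=.
  rewrite size_polyN (leq_trans (size_polyC_leq1 _)) //.
  by rewrite -ltnS prednK ?(ltnW p1).
have : (size (h %% p)%R <= 1)%N.
  move/eqP: r0; rewrite subr_eq0 => /eqP/(congr1 (size \o polyseq)) /=.
  by rewrite size_map_poly => ->; exact: size_polyC_leq1.
move=> /size1_polyC hE; apply: (hk ((h %% p)`_0)).
have /eqP pu : (map_poly c p).[u] == 0 by rewrite pP.
by rewrite hm pu mulr0 add0r {2}hE map_polyC hornerC.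
Qed.

(** Each finite list [S] lies in a simple extension, which embeds in [M] by [lift_generator]; an
    ultralimit over [S] glues these embeddings. The clause on [z] and [y] serves to determine fixed
    fields. *)
Lemma separable_embedding (z : N) (y : M) :
  exists psi : {rmorphism N -> M},
    (forall e, psi (c e) = a e) /\ ((forall e, c e <> z) -> psi z <> y).
Proof.
have /boolp.choice[r rP] : forall S : seq N, exists p : N * M,
    [/\ forall x, x \in z :: S -> exists h, (map_poly c h).[p.1] = x,
     forall g, (map_poly c g).[p.1] = 0 -> (map_poly a g).[p.2] = 0 &
     (forall e, c e <> z) -> forall h, (map_poly c h).[p.1] = z ->
       (map_poly a h).[p.2] <> y].
  move=> S; have [u uS] := common_generator (z :: S).
  have [h hz] := uS z (mem_head _ _).
  have [w [wu wy]] := lift_generator u h y.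
  exists (u, w); split=> // zk g gz /=.
  suff -> : (map_poly a g).[w] = (map_poly a h).[w] by apply: wy; rewrite hz.
  apply/eqP; rewrite -subr_eq0 -hornerN -hornerD -rmorphB wu //.
  by rewrite rmorphB hornerD hornerN gz hz subrr.
(* [r S] holds a generator and its image. [phi S] is the resulting morphism on the field generated,
   and the dummy value 0 elsewhere; the ultrafilter only sees lists that contain the given
   elements. *)
pose phi S x := if pselect (exists h, (map_poly c h).[(r S).1] = x) is left e
  then (map_poly a (projT1 (cid e))).[(r S).2] else 0.
have phiE S h : phi S (map_poly c h).[(r S).1] = (map_poly a h).[(r S).2].
  rewrite /phi; case: pselect => [e|[]]; last by exists h.
  case: cid => g gh /=; have [_ rS _] := rP S.
  apply/eqP; rewrite -subr_eq0 -hornerN -hornerD -rmorphB rS //.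
  by rewrite rmorphB hornerD hornerN gh subrr.
have [|||U UU Uin] :=
    @directed_ultrafilter (seq N) [::] (fun S S' => {subset S <= S'}).
- by move=> S x.
- by move=> S S' S'' SS' S'S'' x /SS' /S'S''.
- by move=> S S'; exists (S ++ S') => x xS; rewrite mem_cat xS ?orbT.
have UF : filter.ProperFilter U by case: UU.
have gen (S0 S : seq N) x : {subset S0 <= S} -> x \in S0 ->
    exists h, (map_poly c h).[(r S).1] = x.
  by move=> sS xS; have [rS _ _] := rP S; apply: rS; rewrite inE sS ?orbT.
have [||||psi psiP] := @ultra_rmorphism _ U UU N M phi.
- move=> x; have [q qsep qx] := N_sep x.
  have [|l lP] := @finite_roots _ (map_poly a q).
    by rewrite map_poly_eq0; exact: separable_poly_neq0.
  exists l; apply: (Uin [:: x]) => S /= sS; apply: lP.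
  have [h hx] := gen _ _ x sS (mem_head _ _).
  rewrite -hx phiE /root -horner_comp -map_comp_poly; apply/eqP.
  have [_ rS _] := rP S; apply: rS.
  by rewrite map_comp_poly horner_comp hx; apply/rootP.
- move=> x x'; apply: (Uin [:: x; x']) => S /= sS.
  have [h <-] := gen _ _ x sS (mem_head _ _).
  have [h' <-] : exists h, (map_poly c h).[(r S).1] = x'.
    by apply: gen sS _; rewrite !inE eqxx orbT.
  by rewrite -hornerN -hornerD -rmorphB !phiE rmorphB hornerD hornerN.
- move=> x x'; apply: (Uin [:: x; x']) => S /= sS.
  have [h <-] := gen _ _ x sS (mem_head _ _).
  have [h' <-] : exists h, (map_poly c h).[(r S).1] = x'.
    by apply: gen sS _; rewrite !inE eqxx orbT.
  by rewrite -hornerM -rmorphM !phiE rmorphM hornerM.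
- apply: (Uin [::]) => S /= _.
  by have := phiE S 1; rewrite !rmorph1 !hornerC.
exists psi; split=> [e|zk].
  apply: (ultra_const UU); apply: filter.filterS (psiP (c e)) => S /= <-.
  by have := phiE S e%:P; rewrite !map_polyC !hornerC.
apply: (ultra_const UU); apply: filter.filterS (psiP z) => S /= <-.
have [rS _ rz] := rP S; have [h hz] := rS z (mem_head _ _).
by rewrite -{1}hz phiE; exact: rz.
Qed.
End SeparableEmbedding.

(** An endomorphism over [F] is injective and maps the finite set of roots of each [q] over [F] to
    itself, hence onto itself. *)
Lemma algebraic_endo_bij (F M : fieldType) (i : {rmorphism F -> M})
    (s : {rmorphism M -> M}) :
  (forall x, exists2 q, q != 0 & root (map_poly i q) x) ->
  (forall y, s (i y) = i y) -> bijective s.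
Proof.
move=> Malg si.
have surj y : exists x, s x = y.
  have [q q0 qy] := Malg y.
  have [|l lP] := @finite_roots _ (map_poly i q); first by rewrite map_poly_eq0.
  pose l' := [seq x <- undup l | root (map_poly i q) x].
  have l'P x : (x \in l') = root (map_poly i q) x.
    by rewrite mem_filter mem_undup; case: (boolP (root _ x)) => // /lP.
  have ul' : uniq l' by rewrite filter_uniq ?undup_uniq.
  have sl' : {subset map s l' <= l'}.
    move=> _ /mapP[x xl' ->]; move: xl'; rewrite !l'P => qx.
    have <- : map_poly s (map_poly i q) = map_poly i q.
      by rewrite -map_poly_comp; apply: eq_map_poly => e; exact: si.
    by rewrite fmorph_root.
  have usl' : uniq (map s l') by rewrite map_inj_uniq //; exact: fmorph_inj.
  have [|_ eql'] := uniq_min_size usl' sl'; first by rewrite size_map.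
  have : y \in l' by rewrite l'P.
  by rewrite -eql' => /mapP[x _ ->]; exists x.
have [g gK] := boolp.choice surj.
exists g => // x; apply: (fmorph_inj s); exact: gK.
Qed.

(** * Automorphisms of a separable closure *)

Section SeparableClosure.
Variables (L M : fieldType) (i : {rmorphism L -> M}).
Hypothesis M_closure : is_sep_closure i.

Let M_alg x : exists2 q, q != 0 & root (map_poly i q) x.
Proof.
have [q [_ qsep qx]] := M_closure.1 x.
by exists q => //; exact: separable_poly_neq0.
Qed.

Lemma gal_aut_of_rmorphism (s : {rmorphism M -> M}) :
  (forall y, s (i y) = i y) -> exists g : gal_aut i, g =1 s.
Proof.
move=> si; exists (GalAut (algebraic_endo_bij M_alg si) si).
by [].
Qed.

(** An element outside the base field is moved by the embedding that [separable_embedding] provides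
    with [y] equal to [x]. *)
Lemma gal_fixed x : infinite_field L -> (forall s : gal_aut i, s x = x) ->
  exists y, i y = x.
Proof.
move=> Linf sx; apply: contrapT => nx.
have [||//|psi [psii psix]] := @separable_embedding L M M i i _ _ _ x x.
- by move=> y; have [q [_ qsep qy]] := M_closure.1 y; exists q.
- exact: M_closure.2.
have [s sE] := gal_aut_of_rmorphism psii.
apply: psix; first by move=> e ex; apply: nx; exists e.
by rewrite -sE sx.
Qed.

(** The hypothesis says that [k] contains a copy of [L] on which [a] and [b] both restrict to [i].
    Then [M] is separable over the image of [a], and [b] extends to [M] along [a]. *)
Lemma gal_extend (k : fieldType) (a b : {rmorphism k -> M}) :
  infinite_field k -> (forall y, exists e, a e = i y /\ b e = i y) ->
  exists s : gal_aut i, forall e, s (a e) = b e.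
Proof.
move=> kinf /boolp.choice[r rP].
have [||//|psi [psia _]] := @separable_embedding k M M a b _ _ _ 0 0.
- move=> y; have [q [_ qsep qy]] := M_closure.1 y.
  have [q' q'E] : exists q' : {poly k}, map_poly a q' = map_poly i q.
    exists (\poly_(j < size q) r q`_j); apply/polyP=> j.
    rewrite !coef_map coef_poly; case: ltnP => [_|jq]; first exact: (rP _).1.
    by rewrite /= [q`_j]nth_default // !rmorph0.
  exists q'; rewrite ?q'E //.
  by rewrite -(separable_map a) q'E separable_map.
- exact: M_closure.2.
have [|s sE] := @gal_aut_of_rmorphism psi.
  by move=> y; rewrite -(rP y).1 psia (rP y).2 (rP y).1.
by exists s => e; rewrite sE.
Qed.

End SeparableClosure.

(** * Morphisms out of fraction fields *)

Lemma fraction_eq (R : idomainType) (x : {fraction R}) :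
  exists2 nd : R * R, nd.2 != 0 & x = tofrac nd.1 / tofrac nd.2.
Proof.
elim/quotW: x => x; exists (frac x) => /=; first exact: denom_ratioP.
apply: (canRL (mulfK _)); first by rewrite tofrac_eq0 denom_ratioP.
unlock tofrac; rewrite -[LHS]FracField.pi_mul; apply/eqmodP.
rewrite /= FracField.equivfE /FracField.mulf.
by rewrite !numden_Ratio ?mulr1 ?oner_neq0 ?denom_ratioP // mulrC.
Qed.

Lemma fraction_rmorphism (R : idomainType) (M : fieldType) (phi : {rmorphism R -> M}) :
  (forall x, phi x = 0 -> x = 0) ->
  exists psi : {rmorphism {fraction R} -> M}, forall x, psi (tofrac x) = phi x.
Proof.
move=> phi0.
have /boolp.choice[r rP] : forall x : {fraction R}, exists nd : R * R,
    nd.2 != 0 /\ x = tofrac nd.1 / tofrac nd.2.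
  by move=> x; have [nd] := fraction_eq x; exists nd.
have phi_neq0 x : x != 0 -> phi x != 0.
  by move=> x0; apply: contra_neq x0; exact: phi0.
pose psi x := phi (r x).1 / phi (r x).2.
have psiE n d : d != 0 -> psi (tofrac n / tofrac d) = phi n / phi d.
  move=> d0; have [rd /eqP] := rP (tofrac n / tofrac d); rewrite /psi.
  move: (r _) rd => [n' d'] /= d'0.
  rewrite eqr_div ?tofrac_eq0 // -!rmorphM tofrac_eq => /eqP nd.
  by apply/eqP; rewrite eqr_div ?phi_neq0 // -!rmorphM nd.
have psiB : zmod_morphism psi.
  move=> x y; have [xd {1}->] := rP x; have [yd {1}->] := rP y.
  rewrite -mulNr addf_div ?tofrac_eq0 // -rmorphN -!rmorphM -rmorphD.
  rewrite psiE ?mulf_neq0 // /psi -mulNr addf_div ?phi_neq0 //.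
  by rewrite !(rmorphM, rmorphD, rmorphN).
have psiM : monoid_morphism psi.
  split.
    have := psiE 1 1 (oner_neq0 _); rewrite !rmorph1 divr1 => ->.
    by rewrite divr1.
  move=> x y; have [xd {1}->] := rP x; have [yd {1}->] := rP y.
  by rewrite mulf_div -!rmorphM psiE ?mulf_neq0 // /psi mulf_div !rmorphM.
pose p : {rmorphism {fraction R} -> M} := HB.pack psi
  (GRing.isZmodMorphism.Build {fraction R} M psi psiB)
  (GRing.isMonoidMorphism.Build {fraction R} M psi psiM).
exists p => x; have := psiE x 1 (oner_neq0 _).
by rewrite !rmorph1 !divr1.
Qed.

(** * Group operations on Galois automorphisms *)

Section GaloisGroup.
Variables (L M : fieldType) (i : {rmorphism L -> M}).

Definition gal_aut_one : gal_aut i :=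
  @GalAut L M i idfun (@Bijective _ _ _ idfun (fun=> erefl) (fun=> erefl))
    (fun=> erefl).

Lemma gal_aut_mul_fix (s s' : gal_aut i) x : (s \o s') (i x) = i x.
Proof. by rewrite /= !gal_fix. Qed.

Definition gal_aut_mul (s s' : gal_aut i) : gal_aut i :=
  @GalAut L M i (s \o s') (bij_comp (gal_bij s) (gal_bij s')) (gal_aut_mul_fix s s').

Lemma gal_aut_inv_exists (s : gal_aut i) :
  exists s' : gal_aut i, cancel s s' /\ cancel s' s.
Proof.
have [g sK gK] := gal_bij s.
have gB : zmod_morphism g.
  by move=> x y; apply: (can_inj sK); rewrite rmorphB !gK.
have gM : monoid_morphism g.
  split; first by apply: (can_inj sK); rewrite rmorph1 gK.
  by move=> x y; apply: (can_inj sK); rewrite rmorphM !gK.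
pose h : {rmorphism M -> M} := HB.pack g
  (GRing.isZmodMorphism.Build M M g gB) (GRing.isMonoidMorphism.Build M M g gM).
have hi x : h (i x) = i x by apply: (can_inj sK); rewrite gK gal_fix.
by exists (@GalAut L M i h (@Bijective _ _ g s gK sK) hi).
Qed.

Definition gal_aut_inv (s : gal_aut i) := projT1 (cid (gal_aut_inv_exists s)).

Lemma gal_aut_invK (s : gal_aut i) : cancel s (gal_aut_inv s).
Proof. by rewrite /gal_aut_inv; case: cid => s' []. Qed.

Lemma gal_aut_invKV (s : gal_aut i) : cancel (gal_aut_inv s) s.
Proof. by rewrite /gal_aut_inv; case: cid => s' []. Qed.

End GaloisGroup.

Lemma tofrac_horner (K : fieldType) (h : {poly K}) :
  tofrac h = (map_poly (@tofrac {poly K} \o polyC) h).[ratfunX K] :> ratfun K.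
Proof.
rewrite map_poly_comp /ratfunX horner_map; congr (tofrac _).
by rewrite -/(h \Po 'X) comp_polyXr.
Qed.

Lemma ratfun_infinite (K : fieldType) : infinite_field (ratfun K).
Proof.
move=> n; exists [seq tofrac ('X^j : {poly K}) | j <- iota 0 n]; last first.
  by rewrite size_map size_iota.
rewrite map_inj_uniq ?iota_uniq // => j k /eqP; rewrite tofrac_eq => /eqP.
by move/(congr1 (size \o polyseq)); rewrite /= !size_polyXn => -[].
Qed.

Lemma infinite_field_ext (k k' : fieldType) (c : {rmorphism k -> k'}) :
  infinite_field k -> infinite_field k'.
Proof.
move=> kinf n; have [s us sn] := kinf n; exists (map c s); last by rewrite size_map.
by rewrite map_inj_uniq //; exact: fmorph_inj.
Qed.

(** * Discriminants and norms *)

Section VandermondeProduct.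
Variables (R : comNzRingType) (n : nat).
Implicit Type v : 'I_n -> R.

Definition vandermonde v : R := \det (Vandermonde n (\row_k v k)).

Lemma vandermondeE v :
  vandermonde v = \prod_(k < n) \prod_(l < n | (k < l)%N) (v l - v k).
Proof.
rewrite /vandermonde det_Vandermonde; apply: eq_bigr => k _.
by apply: eq_bigr => l _; rewrite !mxE.
Qed.

Lemma vandermonde_perm v (p : 'S_n) :
  vandermonde (v \o p) = (-1) ^+ p * vandermonde v.
Proof.
rewrite /vandermonde mulrC -(odd_permV p) -det_perm -det_mulmx -col_permE.
by congr (\det _); apply/matrixP=> k l; rewrite !mxE.
Qed.

(** The pairs with [k < l] and those with [l < k] contribute the same factors up to one sign each;
    [m] counts the pairs. *)
Lemma vandermonde_sqr v : exists m, vandermonde v ^+ 2 =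
  (-1) ^+ m * \prod_(k < n) \prod_(l < n | l != k) (v k - v l).
Proof.
exists (\sum_(k < n) #|[pred l : 'I_n | (k < l)%N]|)%N.
have -> : \prod_(k < n) \prod_(l < n | l != k) (v k - v l) =
    (\prod_(k < n) \prod_(l < n | (k < l)%N) (v k - v l)) * vandermonde v.
  rewrite vandermondeE [X in _ * X](exchange_big_dep xpredT) //= -big_split /=.
  apply: eq_bigr => k _; rewrite (bigID (fun l : 'I_n => (k < l)%N)) /=.
  congr (_ * _); apply: eq_bigl => l; rewrite -val_eqE /=; case: ltngtP => //.
suff -> : \prod_(k < n) \prod_(l < n | (k < l)%N) (v k - v l) =
    (-1) ^+ (\sum_(k < n) #|[pred l : 'I_n | (k < l)%N]|) * vandermonde v.
  by rewrite -mulrA signrMK expr2.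
rewrite vandermondeE expr_sum -big_split /=; apply: eq_bigr => k _.
by rewrite -prodrN; apply: eq_bigr => l _; rewrite opprB.
Qed.

Lemma rmorph_vandermonde (S : comNzRingType) (phi : {rmorphism R -> S}) v :
  phi (vandermonde v) = \det (Vandermonde n (\row_k phi (v k))).
Proof.
rewrite -det_map_mx; congr (\det _).
by apply/matrixP=> k l; rewrite !mxE rmorphXn.
Qed.

End VandermondeProduct.

(** * Norms as determinants of companion matrices *)

Section PolynomialNorm.
Variables (R : comNzRingType) (n : nat).

(** The dimension is fixed independently of [P], so that base change needs no cast; the intended [P]
    is monic of degree [n.+1]. *)
Definition companion (P : {poly R}) : 'M[R]_n.+1 :=
  \matrix_(k, l) if (k == n :> nat) then - P`_l else (k.+1 == l :> nat)%:R.

(* The product of the values of [h] at the roots of the monic polynomial [P] of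
   degree n.+1, computed without adjoining them. *)
Definition poly_norm (P h : {poly R}) : R := \det (horner_mx (companion P) h).

Lemma char_poly_companion P : P \is monic -> size P = n.+2 ->
  char_poly (companion P) = P.
Proof.
move=> Pm sP; have := companionmxK Pm; rewrite /companionmx.
move: (size P) sP => m sP; rewrite sP /= => {2}<-.
by congr (char_poly _).
Qed.

Lemma horner_char_poly (A : 'M[R]_n.+1) c : (char_poly A).[c] = \det (c%:M - A).
Proof.
rewrite -horner_evalE /char_poly -det_map_mx; congr (\det _).
apply/matrixP=> k l; rewrite !mxE /= /horner_eval !hornerE.
by case: (k == l); rewrite ?mulr1n ?mulr0n !hornerE.
Qed.

(** The norm read at the roots of the second argument: for each root, the determinant is up to sign
    the characteristic polynomial [P] evaluated there. *)
Lemma poly_norm_split P (a : R) (s : seq R) : P \is monic -> size P = n.+2 ->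
  poly_norm P (a *: \prod_(c <- s) ('X - c%:P)) =
  a ^+ n.+1 * \prod_(c <- s) ((-1) ^+ n.+1 * P.[c]).
Proof.
move=> Pm sP; rewrite /poly_norm linearZ /= detZ rmorph_prod /=; congr (_ * _).
rewrite (big_morph (@determinant R n.+1) (id1 := 1) (op1 := *%R)); last first.
- exact: det1.
- by move=> A B; exact: det_mulmx.
apply: eq_bigr => c _; rewrite rmorphB /= horner_mx_X horner_mx_C.
rewrite -opprB -scaleN1r detZ -horner_char_poly.
by rewrite char_poly_companion.
Qed.

End PolynomialNorm.

Lemma map_poly_norm (R S : comNzRingType) (phi : {rmorphism R -> S}) n P h :
  phi (poly_norm n P h) = poly_norm n (map_poly phi P) (map_poly phi h).
Proof.
rewrite /poly_norm -det_map_mx map_horner_mx; congr (\det (horner_mx _ _)).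
apply/matrixP=> k l; rewrite !mxE coef_map.
by case: ifP; rewrite ?rmorphN ?rmorph_nat.
Qed.

Lemma horner_mx_eigen (R : comNzRingType) n (A : 'M[R]_n.+1) (v : 'cV_n.+1) b h :
  A *m v = b *: v -> horner_mx A h *m v = h.[b] *: v.
Proof.
move=> Av; elim/poly_ind: h => [|h c IH]; first by rewrite rmorph0 mul0mx horner0 scale0r.
rewrite rmorphD rmorphM /= horner_mx_X horner_mx_C mulmxDl -mulmxA Av.
by rewrite -scalemxAr IH scalerA mul_scalar_mx -scalerDl hornerMXaddC mulrC.
Qed.

(** The norm read at the roots of the first argument: the columns of the Vandermonde matrix are
    eigenvectors of the companion matrix, and its determinant cancels. *)
Lemma poly_norm_roots (F : fieldType) n (s : seq F) (h : {poly F}) :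
  uniq s -> size s = n.+1 ->
  poly_norm n (\prod_(b <- s) ('X - b%:P)) h = \prod_(b <- s) h.[b].
Proof.
move=> us ss; pose P := \prod_(b <- s) ('X - b%:P).
pose V := Vandermonde n.+1 (\row_(k < n.+1) s`_k).
have V0 : \det V != 0.
  rewrite det_Vandermonde; apply/prodf_neq0 => k _; apply/prodf_neq0 => l kl.
  by rewrite !mxE subr_eq0 nth_uniq ?ss // gtn_eqF.
have sP : size P = n.+2 by rewrite size_prod_XsubC ss.
have Pm : P`_n.+1 = 1.
  by have := monic_prod_XsubC s xpredT id; rewrite monicE lead_coefE sP => /eqP.
apply: (mulIf V0); rewrite /poly_norm -det_mulmx.
have -> : horner_mx (companion n P) h *m V = V *m diag_mx (\row_k h.[s`_k]).
  apply/matrixP=> k l; transitivity ((horner_mx (companion n P) h *m col l V) k 0).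
    by rewrite !mxE; apply: eq_bigr => m _; rewrite !mxE.
  rewrite (@horner_mx_eigen _ _ _ _ s`_l).
    by rewrite mul_mx_diag !mxE mulrC.
  apply/matrixP=> m z; rewrite !mxE.
  have [mn|mn] := eqVneq (m : nat) n.
    have /eqP : P.[s`_l] = 0.
      by apply/rootP; rewrite root_prod_XsubC mem_nth // ss.
    rewrite (@horner_coef_wide _ n.+2) ?sP // big_ord_recr /= Pm mul1r.
    rewrite addrC addr_eq0 -exprS mn => /eqP->; rewrite -sumrN.
    by apply: eq_bigr => q _; rewrite !mxE mn eqxx mulNr.
  have mn1 : (m.+1 < n.+1)%N by rewrite ltnS ltn_neqAle mn -ltnS ltn_ord.
  rewrite (bigD1 (Ordinal mn1)) //= !mxE (negPf mn) eqxx mul1r exprS big1 ?addr0 //.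
  move=> q qm; rewrite !mxE (negPf mn); case: eqP => [mq|]; last by rewrite mul0r.
  by case/eqP: qm; apply: val_inj.
rewrite det_mulmx det_diag mulrC; congr (_ * _).
rewrite [RHS](big_nth 0) ss big_mkord.
by apply: eq_bigr => k _; rewrite !mxE.
Qed.

(** * The Galois action on the preimage tree *)

Lemma tree_aut_eq (L M : fieldType) (i : {rmorphism L -> M}) (f : {poly L}) (t : L)
  (g h : tree_aut i f t) : g =1 h -> g = h.
Proof.
case: g h => [g gb gr ga] [h hb hr ha] /= /funext gh; subst h.
by congr TreeAut; exact: Prop_irrelevance.
Qed.

(** * Labelling of the tree by words, and portraits of Galois elements *)

Section Labelling.
Variables (K : fieldType) (f : {poly K}) (d : nat).
Hypotheses (deg_f : size f = d.+1) (d_gt1 : (1 < d)%N).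
Variables (E : splittingFieldType (ratfun K)).
Hypothesis E_split : splittingFieldFor 1%VS
  (map_poly (in_alg E) (ratfun_poly f - (ratfunX K)%:P)) fullv.
Variables (rs : d.-tuple E) (rs_uniq : uniq rs).
Hypothesis rs_roots : forall x : E,
  (x \in rs) = root (map_poly (in_alg E) (ratfun_poly f - (ratfunX K)%:P)) x.
Hypothesis gal_E : forall p : 'S_d, ~~ odd_perm p -> p \in gal_perms rs.
Variables (M : fieldType) (i : {rmorphism ratfun K -> M}).
Hypothesis M_closure : is_sep_closure i.

Definition const_emb : {rmorphism K -> M} := i \o (@tofrac {poly K} \o polyC).
Arguments const_emb : simpl never.
Local Notation iK := const_emb.
Local Notation fM := (map_poly iK f).
Local Notation t := (i (ratfunX K)).
(** Transcendence over [K] is what allows the specialization of the indeterminate to [x]; it passes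
    to preimages, hence to every vertex. *)
Definition transcendental (x : M) :=
  forall h : {poly K}, (map_poly iK h).[x] = 0 -> h = 0.

Lemma map_ratfun_poly h : map_poly i (ratfun_poly h) = map_poly iK h.
Proof. by rewrite /ratfun_poly -map_poly_comp. Qed.

Lemma i_tofrac (h : {poly K}) : i (tofrac h) = (map_poly iK h).[t].
Proof. by rewrite tofrac_horner -horner_map map_ratfun_poly. Qed.

Lemma transcendental_t : transcendental t.
Proof.
by move=> h /eqP; rewrite -i_tofrac fmorph_eq0 tofrac_eq0 => /eqP.
Qed.

Lemma transcendental_preimage x : transcendental fM.[x] -> transcendental x.
Proof.
move=> tx h hx; apply/eqP/negPn/negP => h0.
have [||p pmon /rootP px] := @integral_horner _ _ iK fM x.
- move=> y /(nthP 0)[j _ <-]; rewrite coef_map; exact: integral_id.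
- by apply/integral_algebraic; exists h => //; apply/rootP.
- by have := monic_neq0 pmon; rewrite (tx p px) eqxx.
Qed.

Lemma transcendental_gal (s : gal_aut i) x : transcendental x -> transcendental (s x).
Proof.
move=> tx h; rewrite -map_ratfun_poly -gal_map_poly map_ratfun_poly => /eqP.
by rewrite fmorph_eq0 => /eqP; exact: tx.
Qed.

Lemma size_fM : size fM = d.+1.
Proof. by rewrite size_map_poly. Qed.

(** The [d] listed roots are distinct, so f(x) - t is separable and its splitting field is
    Galois. *)
Lemma E_separable (x : E) :
  exists2 q, separable_poly q & root (map_poly (in_alg E) q) x.
Proof.
pose P := map_poly (in_alg E) (ratfun_poly f - (ratfunX K)%:P).
have sP : size P = d.+1.
  have sf : size (ratfun_poly f) = d.+1 by rewrite size_map_poly.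
  rewrite size_map_poly size_polyDl sf // size_polyN.
  exact: leq_ltn_trans (size_polyC_leq1 _) (leqW d_gt1).
have DP : P = lead_coef P *: \prod_(y <- rs) ('X - y%:P).
  apply: all_roots_prod_XsubC; rewrite ?sP ?size_tuple //; last first.
    by rewrite uniq_rootsE.
  by apply/allP=> y; rewrite rs_roots.
have Psep : separable_poly P.
  have: P %= \prod_(y <- rs) ('X - y%:P).
    rewrite [P in P %= _]DP eqp_scale // lead_coef_eq0 -size_poly_gt0 sP //.
  by move/eqp_separable->; rewrite separable_prod_XsubC.
have : galois 1%VS {:E}.
  apply/splitting_galoisField; exists P; split=> //.
  by apply/polyOverP=> j; rewrite coef_map; apply: rpredZ; exact: rpred1.
case/and3P=> _ /separableP/(_ x (memvf x)) xsep _.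
have [q Dq] : exists q, minPoly 1 x = map_poly (in_alg E) q.
  have /polyOver1P[q ->] := minPolyOver 1 x; by exists q.
exists q; last by rewrite -Dq root_minPoly.
by rewrite -(separable_map (in_alg E)) -Dq; exact: xsep.
Qed.

Lemma iota_exists x : transcendental x ->
  exists io : {rmorphism E -> M},
    forall h : {poly K}, io (in_alg E (tofrac h)) = (map_poly iK h).[x].
Proof.
move=> tx.
have [a aE] := @fraction_rmorphism _ _ (horner_eval x \o map_poly iK) tx.
have [psi [psiE _]] := @separable_embedding _ E M (in_alg E) a E_separable
  M_closure.2 (@ratfun_infinite K) 0 0.
by exists psi => h; rewrite psiE aE.
Qed.

(** One embedding of [E] above each [x] is chosen once and for all; at an algebraic [x] it is a
    dummy, the embedding above t. *)
Definition iota (x : M) : {rmorphism E -> M} :=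
  if pselect (transcendental x) is left tx
  then projT1 (cid (iota_exists tx)) else projT1 (cid (iota_exists transcendental_t)).

Lemma iotaE x h : transcendental x ->
  iota x (in_alg E (tofrac h)) = (map_poly iK h).[x].
Proof. by move=> tx; rewrite /iota; case: pselect => // ?; case: cid. Qed.

Definition preim_label (x : M) (k : 'I_d) : M := iota x (tnth rs k).
Local Notation r := preim_label.

Lemma preim_label_inj x : injective (r x).
Proof.
by move=> k l /fmorph_inj; exact: (tuple_uniqP rs rs_uniq).
Qed.

Lemma horner_preim_label x k : transcendental x -> fM.[r x k] = x.
Proof.
move=> tx; have /rootP : root (map_poly (in_alg E)
    (ratfun_poly f - (ratfunX K)%:P)) (tnth rs k) by rewrite -rs_roots mem_tnth.
rewrite rmorphB hornerD hornerN /= map_polyC hornerC => /eqP.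
rewrite subr_eq0 => /eqP/(congr1 (iota x)).
rewrite iotaE // map_polyX hornerX -horner_map -!map_poly_comp => {2}<-.
congr (_.[_]); apply: eq_map_poly => e /=.
by have := iotaE e%:P tx; rewrite map_polyC hornerC => ->.
Qed.

Lemma transcendental_preim_label x k : transcendental x -> transcendental (r x k).
Proof. by move=> tx; apply: transcendental_preimage; rewrite horner_preim_label. Qed.

Lemma preim_labelP x y : transcendental x -> fM.[y] = x -> exists k, y = r x k.
Proof.
move=> tx yx; apply: contrapT => ny.
have: (size (y :: [seq r x k | k <- enum 'I_d]) < size (fM - x%:P)%R)%N.
  apply: max_poly_roots.
  - rewrite -size_poly_gt0 size_polyDl size_fM // size_polyN.
    exact: leq_ltn_trans (size_polyC_leq1 _) (leqW d_gt1).
  - apply/allP=> z; rewrite inE /root hornerD hornerN hornerC subr_eq0.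
    case/orP=> [/eqP->|/mapP[k _ ->]]; first by rewrite yx.
    by rewrite horner_preim_label.
  - rewrite /= map_inj_uniq ?enum_uniq ?andbT; last exact: preim_label_inj.
    by apply/negP => /mapP[k _ yk]; apply: ny; exists k.
rewrite /= size_map size_enum_ord size_polyDl size_fM ?ltnn // size_polyN.
exact: leq_ltn_trans (size_polyC_leq1 _) (leqW d_gt1).
Qed.

Lemma gal_label_perm_exists (s : gal_aut i) x : transcendental x ->
  exists p : 'S_d, forall k, s (r x k) = r (s x) (p k).
Proof.
move=> tx; have /boolp.choice[p pE] : forall k, exists l, s (r x k) = r (s x) l.
  move=> k; apply: preim_labelP; first exact: transcendental_gal.
  by rewrite -map_ratfun_poly -gal_map_poly map_ratfun_poly horner_preim_label.
have p_inj : injective p.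
  move=> k l pkl; apply: (@preim_label_inj x).
  by apply: (bij_inj (gal_bij s)); rewrite !pE pkl.
by exists (perm p_inj) => k; rewrite permE pE.
Qed.

Definition gal_label_perm s x : 'S_d :=
  if pselect (transcendental x) is left tx
  then projT1 (cid (gal_label_perm_exists s tx)) else 1%g.

Lemma gal_label_permE (s : gal_aut i) x k : transcendental x ->
  s (r x k) = r (s x) (gal_label_perm s x k).
Proof. by move=> tx; rewrite /gal_label_perm; case: pselect => // ?; case: cid. Qed.

Fixpoint vertex_of (w : seq 'I_d) : M :=
  if w is k :: w' then r (vertex_of w') k else t.

Lemma transcendental_vertex w : transcendental (vertex_of w).
Proof.
elim: w => [|k w IH] /=; [exact: transcendental_t|exact: transcendental_preim_label].
Qed.

Lemma vertex_of_inj w w' : size w = size w' -> vertex_of w = vertex_of w' -> w = w'.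
Proof.
elim: w w' => [|k w IH] [|k' w'] //= [sw] kw.
have ww' : w = w'.
  apply: IH => //; have := congr1 (horner fM) kw.
  by rewrite !horner_preim_label //; exact: transcendental_vertex.
by move: kw; rewrite ww' => /preim_label_inj->.
Qed.

Definition portrait (s : gal_aut i) w : 'S_d := gal_label_perm s (vertex_of w).

Lemma gal_vertex_of (s : gal_aut i) w :
  s (vertex_of w) = vertex_of (word_act portrait s w).
Proof.
elim: w => [|k w IH] /=; first exact: gal_fix.
by rewrite gal_label_permE; [rewrite IH|exact: transcendental_vertex].
Qed.

Lemma portraitP (s : gal_aut i) w (p : 'S_d) :
  (forall k, s (r (vertex_of w) k) = r (s (vertex_of w)) (p k)) -> portrait s w = p.
Proof.
move=> sp; apply/permP=> k; apply: (@preim_label_inj (s (vertex_of w))).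
by rewrite -sp gal_label_permE //; exact: transcendental_vertex.
Qed.

Lemma portrait_one w : portrait (gal_aut_one i) w = 1%g.
Proof. by apply: portraitP => k; rewrite perm1. Qed.

Lemma portrait_mul s s' w :
  portrait (gal_aut_mul s s') w = (portrait s' w * portrait s (word_act portrait s' w))%g.
Proof.
apply: portraitP => k; have tw := transcendental_vertex.
rewrite /= gal_label_permE // permM [s' (vertex_of w)]gal_vertex_of.
by rewrite [LHS]gal_label_permE.
Qed.

Lemma portrait_mulV s w : portrait (gal_aut_mul s (gal_aut_inv s)) w = 1%g.
Proof. by apply: portraitP => k; rewrite perm1 /= !gal_aut_invKV. Qed.

Lemma portrait_mulVl s w : portrait (gal_aut_mul (gal_aut_inv s) s) w = 1%g.
Proof. by apply: portraitP => k; rewrite perm1 /= !gal_aut_invK. Qed.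

Lemma iter_polyE n x : (map_poly iK (iter_poly f n)).[x] = iter n (horner fM) x.
Proof.
elim: n x => [|n IH] x /=; first by rewrite map_polyX hornerX.
by rewrite map_comp_poly horner_comp IH.
Qed.

Lemma iter_vertex_of w : iter (size w) (horner fM) (vertex_of w) = t.
Proof.
elim: w => //= k w IH.
by rewrite -iterS iterSr horner_preim_label //; exact: transcendental_vertex.
Qed.

(** As t is the image of the vertex under an iterate of f, the field K(t) lies in the field
    generated over [K] by the vertex; the substitution is composition with that iterate. *)
Lemma i_factors_iota w (y : ratfun K) :
  exists y', i y = iota (vertex_of w) (in_alg E y').
Proof.
have tw := @transcendental_vertex w.
have iE h : i (tofrac h) =
    iota (vertex_of w) (in_alg E (tofrac (h \Po iter_poly f (size w)))).
  by rewrite iotaE // i_tofrac map_comp_poly horner_comp iter_polyE iter_vertex_of.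
have [[n m] /= m0 ->] := fraction_eq y.
exists (tofrac (n \Po iter_poly f (size w)) / tofrac (m \Po iter_poly f (size w))).
rewrite fmorph_div !iE -fmorph_div; congr (iota _ _).
by rewrite -(fmorph_div (in_alg E)).
Qed.

(** Twisting the embedding of [E] above the vertex by an element of its Galois group changes nothing
    on K(t), so [gal_extend] realizes the twist by a Galois element, which fixes the vertex. *)
Lemma portrait_even_stab w (p : 'S_d) : ~~ odd_perm p ->
  exists2 s, word_act portrait s w = w & portrait s w = p.
Proof.
move=> /gal_E; rewrite inE => /existsP[g /andP[_ /forallP gp]].
have [||s sE] := gal_extend M_closure (a := iota (vertex_of w))
  (b := iota (vertex_of w) \o g).
- exact: infinite_field_ext (in_alg E) (@ratfun_infinite K).
- move=> y; have [y' yE] := i_factors_iota w y; exists (in_alg E y').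
  rewrite yE; split=> //=; congr (iota _ _).
  by rewrite linearZ /= rmorph1.
have sw : s (vertex_of w) = vertex_of w.
  have := iotaE 'X (@transcendental_vertex w).
  rewrite map_polyX hornerX => <-; rewrite sE /=; congr (iota _ _).
  by rewrite linearZ /= rmorph1.
exists s; last first.
  by apply: portraitP => k; rewrite sw [LHS]sE /= (eqP (gp k)).
by apply: vertex_of_inj; rewrite ?size_word_act // -gal_vertex_of.
Qed.


(** * Square roots of the discriminants of a level *)

Definition disc_root n : M := \prod_(w <- words d n) vandermonde (r (vertex_of w)).

Lemma gal_disc_root (s : gal_aut i) n :
  s (disc_root n) = (-1) ^+ (level_sgn portrait n s) * disc_root n.
Proof.
have sE w : s (vandermonde (r (vertex_of w))) = (-1) ^+ (odd_perm (portrait s w)) *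
    vandermonde (r (vertex_of (word_act portrait s w))).
  rewrite rmorph_vandermonde -vandermonde_perm -gal_vertex_of /vandermonde.
  congr (\det (Vandermonde _ _)); apply/rowP=> k; rewrite !mxE.
  by rewrite gal_label_permE //; exact: transcendental_vertex.
rewrite rmorph_prod; under eq_bigr => w _ do rewrite sE.
rewrite big_split /=; congr (_ * _).
  rewrite /level_sgn /parity.
  rewrite (big_morph (fun b : bool => (-1) ^+ b : M) (id1 := 1) (op1 := *%R)) //.
  by move=> b b'; rewrite signr_addb.
rewrite /disc_root; have pw := perm_act_words portrait_mul portrait_mulV
  portrait_mulVl n s.
by rewrite -[in RHS](perm_big _ pw) big_map.
Qed.

Lemma vandermonde_label_neq0 x : vandermonde (r x) != 0.
Proof.
rewrite vandermondeE; apply/prodf_neq0 => k _; apply/prodf_neq0 => l kl.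
rewrite subr_eq0; apply: contraL kl => /eqP/preim_label_inj->.
by rewrite ltnn.
Qed.

Lemma disc_root_neq0 n : disc_root n != 0.
Proof.
by rewrite prodf_seq_neq0; apply/allP=> w _; exact: vandermonde_label_neq0.
Qed.

Lemma fM_sub_prod x : transcendental x ->
  fM - x%:P = iK (lead_coef f) *: \prod_(k < d) ('X - (r x k)%:P).
Proof.
move=> tx.
have lt1 : (size (- x%:P)%R < size fM)%N.
  rewrite size_polyN size_fM.
  exact: leq_ltn_trans (size_polyC_leq1 _) (leqW d_gt1).
have := @all_roots_prod_XsubC _ (fM - x%:P) [seq r x k | k <- enum 'I_d].
rewrite size_polyDl // size_fM size_map size_enum_ord => /(_ erefl).
rewrite big_map big_enum lead_coefDl // lead_coef_map; apply.
  apply/allP=> z /mapP[k _ ->]; rewrite /root hornerD hornerN hornerC subr_eq0.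
  by rewrite horner_preim_label.
rewrite uniq_rootsE map_inj_uniq ?enum_uniq //; exact: preim_label_inj.
Qed.

Lemma deriv_preim_label x k : transcendental x ->
  fM^`().[r x k] = iK (lead_coef f) * \prod_(l < d | l != k) (r x k - r x l).
Proof.
move=> tx; have -> : fM^`() = (fM - x%:P)^`() by rewrite derivB derivC subr0.
rewrite fM_sub_prod // derivZ hornerZ (bigD1 k) //= derivM derivXsubC mul1r.
rewrite hornerD hornerM hornerXsubC subrr mul0r addr0 horner_prod.
by congr (_ * _); apply: eq_bigr => l _; rewrite hornerXsubC.
Qed.

Lemma lead_f_neq0 : lead_coef f != 0.
Proof. by rewrite lead_coef_eq0 -size_poly_gt0 deg_f. Qed.

Lemma vandermonde_label_sqr x : transcendental x ->
  exists2 u, u != 0 & vandermonde (r x) ^+ 2 = iK u * \prod_(k < d) fM^`().[r x k].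
Proof.
move=> tx; have [m ->] := vandermonde_sqr (r x).
exists ((-1) ^+ m * (lead_coef f ^+ d)^-1).
  by rewrite mulf_neq0 ?signr_eq0 // invr_eq0 expf_neq0 // lead_f_neq0.
rewrite (eq_bigr _ (fun k _ => deriv_preim_label k tx)).
rewrite big_split prodr_const card_ord (rmorphM iK) (rmorph_sign iK).
rewrite (fmorphV iK) (rmorphXn iK) -mulrA mulKf // expf_neq0 //.
by rewrite (fmorph_eq0 iK) lead_f_neq0.
Qed.

(** The discriminant of f(x) - y is, up to a constant, the product of f' over the fibre of y; this
    moves the product from level n to level n+1. *)
Lemma disc_root_sqr n : exists2 u, u != 0 &
  disc_root n ^+ 2 = iK u * \prod_(w <- words d n.+1) fM^`().[vertex_of w].
Proof.
have /boolp.choice[u uP] : forall w : seq 'I_d, exists u, u != 0 /\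
    vandermonde (r (vertex_of w)) ^+ 2 =
    iK u * \prod_(k < d) fM^`().[r (vertex_of w) k].
  by move=> w; have [u u0 uE] := vandermonde_label_sqr (@transcendental_vertex w);
    exists u.
exists (\prod_(w <- words d n) u w).
  by rewrite prodf_seq_neq0; apply/allP=> w _; exact: (uP w).1.
rewrite /disc_root -prodrXl rmorph_prod /= big_allpairs_dep -big_split /=.
by apply: eq_bigr => w _; rewrite (uP w).2 big_enum.
Qed.

Lemma size_words n : size (words d n) = (d ^ n)%N.
Proof. by elim: n => //= n IH; rewrite size_allpairs IH size_enum_ord expnSr. Qed.

Lemma size_iter_poly n : size (iter_poly f n) = (d ^ n).+1.
Proof.
elim: n => [|n IH]; first by rewrite size_polyX.
have := size_comp_poly f (iter_poly f n); rewrite deg_f IH /= -expnS.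
case: (size _) => [/=|m /= ->] // /esym/eqP.
by rewrite expn_eq0 andbT => /eqP d0; have := d_gt1; rewrite d0.
Qed.

Lemma expn_d_gt0 n : (0 < d ^ n)%N.
Proof. by rewrite expn_gt0 ltnW. Qed.

(** * The norm of f' from a level, as a polynomial in t *)

Section LevelNorm.
Variable n : nat.
Local Notation a := (lead_coef (iter_poly f n)).

(** This is f^n(x) - t made monic in x, with coefficients in K[t]: the inner ['X] stands for t. *)
Definition level_monic : {poly {poly K}} :=
  map_poly polyC (a^-1 *: iter_poly f n) - (a^-1 *: 'X)%:P.

Lemma lead_iter_neq0 : a != 0.
Proof. by rewrite lead_coef_eq0 -size_poly_gt0 size_iter_poly. Qed.

Let iterZ : size (a^-1 *: iter_poly f n) = (d ^ n).-1.+2.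
Proof.
by rewrite size_scale ?invr_eq0 ?lead_iter_neq0 // size_iter_poly prednK // expn_d_gt0.
Qed.

Let lt_level : (size (- (a^-1 *: 'X)%:P : {poly {poly K}})%R <
  size (map_poly polyC (a^-1 *: iter_poly f n))%R)%N.
Proof.
rewrite size_polyN size_map_polyC iterZ.
exact: leq_ltn_trans (size_polyC_leq1 _) _.
Qed.

Lemma size_level_monic : size level_monic = (d ^ n).-1.+2.
Proof. by rewrite size_polyDl // size_map_polyC iterZ. Qed.

Lemma level_monic_monic : level_monic \is monic.
Proof.
rewrite monicE lead_coefDl // lead_coef_map_inj //; last exact: polyC_inj.
by rewrite lead_coefZ mulVf ?lead_iter_neq0.
Qed.

Definition level_norm : {poly K} :=
  poly_norm (d ^ n).-1 level_monic (map_poly polyC f^`()).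

Lemma level_monic_prod : map_poly (i \o @tofrac _) level_monic =
  \prod_(w <- words d n) ('X - (vertex_of w)%:P).
Proof.
pose phi : {rmorphism {poly K} -> M} := i \o @tofrac _.
have mP : map_poly phi level_monic \is monic.
  rewrite monicE lead_coef_map_inj ?(monicP level_monic_monic) ?rmorph1 ?rmorph0 //.
  by move=> x y /fmorph_inj/eqP; rewrite tofrac_eq => /eqP.
have sP : size (map_poly phi level_monic) = (d ^ n).+1.
  rewrite size_map_inj_poly ?rmorph0 // ?size_level_monic ?prednK ?expn_d_gt0 //.
  by move=> x y /fmorph_inj/eqP; rewrite tofrac_eq => /eqP.
have := @all_roots_prod_XsubC _ (map_poly phi level_monic)
  [seq vertex_of w | w <- words d n].
rewrite size_map size_words sP (monicP mP) scale1r big_map; apply=> //.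
  apply/allP=> _ /mapP[w wn ->]; rewrite /root.
  rewrite rmorphB /= map_polyC /= hornerD hornerN hornerC -map_poly_comp.
  rewrite -[map_poly _ _]/(map_poly iK _) map_polyZ hornerZ iter_polyE.
  move: wn; rewrite mem_words => /eqP <-; rewrite iter_vertex_of -mul_polyC.
  by rewrite tofracM (rmorphM i) subrr.
rewrite uniq_rootsE map_inj_in_uniq ?uniq_words // => w w'.
rewrite !mem_words => /eqP wn /eqP w'n; apply: vertex_of_inj.
by rewrite wn w'n.
Qed.

Lemma i_level_norm :
  i (tofrac level_norm) = \prod_(w <- words d n) fM^`().[vertex_of w].
Proof.
pose phi : {rmorphism {poly K} -> M} := i \o @tofrac _.
rewrite -[LHS]/(phi level_norm) map_poly_norm level_monic_prod.
rewrite -(big_map (@vertex_of) xpredT (fun x => 'X - x%:P)) poly_norm_roots.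
- rewrite big_map -map_poly_comp; apply: eq_bigr => w _.
  by rewrite -[map_poly (_ \o _) _]/(map_poly iK _) deriv_map.
- rewrite map_inj_in_uniq ?uniq_words // => w w'.
  rewrite !mem_words => /eqP wn /eqP w'n; apply: vertex_of_inj.
  by rewrite wn w'n.
- by rewrite size_map size_words prednK // expn_d_gt0.
Qed.

(** Here the norm is read at the critical points: at such a c, the monic form of f^n(x) - t is a
    constant multiple of t - f^n(c). *)
Lemma level_norm_split (Omega : fieldType) (j : {rmorphism K -> Omega})
    (Gamma : seq Omega) : f^`() != 0 -> root_multiset (map_poly j f^`()) Gamma ->
  exists2 u, u != 0 & map_poly j level_norm =
    u *: \prod_(b <- iter_multiset (map_poly j f) n Gamma) ('X - b%:P).
Proof.
move=> f'0 GammaE; pose phi : {rmorphism {poly K} -> {poly Omega}} := map_poly j.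
pose b := lead_coef (map_poly j f^`()); pose N := (d ^ n).-1.+1.
have phiC h : map_poly phi (map_poly polyC h) = map_poly polyC (map_poly j h).
  by rewrite -!map_poly_comp; apply: eq_map_poly => e /=; exact: map_polyC.
have b0 : b != 0 by rewrite lead_coef_eq0 map_poly_eq0.
have phiI : injective phi by exact: map_poly_inj.
have lmE : map_poly phi level_monic =
    map_poly polyC (map_poly j (a^-1 *: iter_poly f n)) - (j a^-1 *: 'X)%:P.
  rewrite rmorphB /= phiC map_polyC /=; congr (_ - _%:P).
  by rewrite map_polyZ map_polyX.
exists (b ^+ N * \prod_(c <- Gamma) ((-1) ^+ N * - j a^-1)).
  rewrite mulf_neq0 ?expf_neq0 // prodf_seq_neq0; apply/allP=> c _ /=.
  by rewrite mulf_neq0 ?signr_eq0 // oppr_eq0 fmorph_eq0 invr_eq0 lead_iter_neq0.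
rewrite -[LHS]/(phi level_norm) map_poly_norm phiC GammaE -/b map_polyZ rmorph_prod /=.
have -> : \prod_(c <- Gamma) map_poly polyC ('X - c%:P) =
    \prod_(c <- [seq c%:P | c <- Gamma]) ('X - c%:P).
  by rewrite big_map; apply: eq_bigr => c _; rewrite rmorphB /= map_polyX map_polyC.
rewrite poly_norm_split; first last.
- by rewrite size_map_inj_poly ?rmorph0 // size_level_monic.
- by rewrite monicE lead_coef_map_inj ?(monicP level_monic_monic) ?rmorph1 ?rmorph0.
rewrite /iter_multiset !big_map -rmorphXn -mul_polyC rmorphM -mulrA; congr (_ * _).
rewrite rmorph_prod -big_split; apply: eq_bigr => c _ /=.
rewrite lmE hornerD hornerN hornerC horner_map /= map_polyZ hornerZ.
have -> : (map_poly j (iter_poly f n)).[c] = (iter_poly (map_poly j f) n).[c].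
  congr (_.[_]); elim: (n) => [|m IH]; first exact: map_polyX.
  by rewrite /= map_comp_poly IH.
rewrite -mul_polyC !rmorphM rmorphN rmorph_sign /=.
by rewrite -mulrA; congr (_ * _); rewrite mulNr mulrBr opprB.
Qed.
End LevelNorm.

Lemma level_norm_neq0 n : level_norm n.+1 != 0.
Proof.
have [u _ uE] := disc_root_sqr n.
have := disc_root_neq0 n; rewrite -sqrf_eq0 uE mulf_eq0 negb_or -i_level_norm.
by case/andP=> _; rewrite fmorph_eq0 tofrac_eq0.
Qed.

Lemma deriv_f_neq0 : f^`() != 0.
Proof.
apply: contraTneq (disc_root_neq0 0) => f'0; apply/negPn.
have [u _ uE] := disc_root_sqr 0.
rewrite -sqrf_eq0 uE deriv_map f'0 rmorph0 mulf_eq0; apply/orP; right.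
rewrite prodf_seq_eq0; apply/hasP.
exists [:: Ordinal d_gt1]; first by rewrite mem_words.
by rewrite /= horner0.
Qed.

(** * Independence of the sign characters *)

Section Independence.
Variables (Omega : fieldType) (j : {rmorphism K -> Omega}) (Gamma : seq Omega).
Hypothesis Gamma_roots : root_multiset (map_poly j f^`()) Gamma.
Hypothesis Gamma_odd : forall n : nat,
  ~ (odd_elts (iter_multiset (map_poly j f) n Gamma) `<=`
     \bigcup_(k < n) odd_elts (iter_multiset (map_poly j f) k Gamma))%classic.

Lemma mup_level_norm n y : odd (mup y (map_poly j (level_norm n))) =
  odd (count_mem y (iter_multiset (map_poly j f) n Gamma)).
Proof.
have [u u0 ->] := level_norm_split n deriv_f_neq0 Gamma_roots.
by rewrite -mul_polyC mupMr ?mu_prod_XsubC // rootC.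
Qed.

(** A relation between signs makes the product [x] of the [disc_root] involved Galois invariant, so
    [x] lies in K(t) and the product [Q] of level norms is a square there. A point of odd
    multiplicity forbids this. *)
Lemma disc_root_indep n (b : nat -> bool) :
  ~ (forall s, level_sgn portrait n s =
       \big[addb/false]_(k < n) (b k && level_sgn portrait k s)).
Proof.
move=> sgnE.
pose x := disc_root n * \prod_(k < n) disc_root k ^+ b k.
have [s|z zx] := gal_fixed M_closure (x := x) (@ratfun_infinite K).
  have -> : s x = (-1) ^+ (level_sgn portrait n s (+)
      \big[addb/false]_(k < n) (b k && level_sgn portrait k s)) * x.
    rewrite signr_addb rmorphM /= gal_disc_root rmorph_prod /x -!mulrA; congr (_ * _).
    rewrite mulrCA; congr (_ * _).
    rewrite (big_morph (fun b : bool => (-1) ^+ b : M) (id1 := 1) (op1 := *%R)) //;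
      last by move=> e e'; rewrite signr_addb.
    rewrite -big_split; apply: eq_bigr => k _ /=; rewrite rmorphXn /= gal_disc_root.
    by case: (b k); rewrite ?expr1 ?expr0 ?mul1r.
  by rewrite -sgnE addbb mul1r.
have /boolp.choice[u uP] : forall k, exists u, u != 0 /\
    disc_root k ^+ 2 = i (tofrac (u *: level_norm k.+1)).
  move=> k; have [u u0 uE] := disc_root_sqr k; exists u; split=> //.
  by rewrite uE -mul_polyC tofracM (rmorphM i) i_level_norm.
pose Q := u n *: level_norm n.+1 * \prod_(k < n) (u k *: level_norm k.+1) ^+ b k.
have xQ : x ^+ 2 = i (tofrac Q).
  rewrite /x exprMn (uP n).2 -prodrXl /Q tofracM (rmorphM i).
  congr (_ * _); rewrite !rmorph_prod; apply: eq_bigr => k _.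
  by rewrite -exprM mulnC exprM (uP k).2 !rmorphXn.
have [[p q] /= q0 zE] := fraction_eq z.
have pqE : p ^+ 2 = q ^+ 2 * Q.
  apply/eqP; rewrite -tofrac_eq -(inj_eq (fmorph_inj i)) tofracM (rmorphM i) -xQ.
  rewrite -zx zE !rmorphXn /= -exprMn -(rmorphM i) [tofrac q * _]mulrC divfK //.
  by rewrite tofrac_eq0.
(* Level [k] involves the (k+1)-st iterate of [Gamma], hence the hypothesis at [n.+1]: [y] has odd
   multiplicity there and even multiplicity for all smaller indices. *)
apply: (Gamma_odd (n := n.+1)) => y yn; apply: contrapT => yk.
have nk k : (k < n.+1)%N ->
    odd (count_mem y (iter_multiset (map_poly j f) k Gamma)) = false.
  by move=> kn; apply/negbTE/negP => ok; apply: yk; exists k.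
have jlN0 k : map_poly j (u k *: level_norm k.+1) != 0.
  by rewrite map_poly_eq0 scale_poly_eq0 negb_or (uP k).1 level_norm_neq0.
have mupX (g : {poly Omega}) m : g != 0 -> mup y (g ^+ m) = (m * mup y g)%N.
  move=> g0; elim: m => [|m IH].
    by rewrite expr0 mupNroot // root1.
  by rewrite exprS mupM ?expf_neq0 // IH mulSn.
have mupl k : odd (mup y (map_poly j (u k *: level_norm k.+1))) =
    odd (count_mem y (iter_multiset (map_poly j f) k.+1 Gamma)).
  rewrite map_polyZ -mul_polyC mupMr ?mup_level_norm // rootC fmorph_eq0.
  exact: (uP k).1.
have even_prod : odd (mup y (map_poly j (\prod_(k < n) (u k *: level_norm k.+1) ^+ b k)))
    = false /\ map_poly j (\prod_(k < n) (u k *: level_norm k.+1) ^+ b k) != 0.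
  elim/big_ind: _ => [|g h [og g0] [oh h0]|k _].
  - by rewrite rmorph1 mupNroot ?root1 ?oner_neq0.
  - by rewrite rmorphM mupM // oddD og oh mulf_neq0.
  - rewrite rmorphXn /= mupX // expf_neq0 // oddM mupl nk ?andbF //.
    by rewrite ltnS ltn_ord.
have p0 : p != 0.
  rewrite -sqrf_eq0 pqE mulf_eq0 negb_or expf_eq0 /= q0 /Q.
  rewrite -(map_poly_eq0 j) rmorphM mulf_neq0 //; first exact: jlN0.
  exact: even_prod.2.
(* The multiplicity of [y] is even on the left of [pqE] and odd on the right. *)
have := congr1 (odd \o mup y \o map_poly j) pqE; rewrite /= rmorphXn rmorphM rmorphXn /=.
have jp0 : map_poly j p != 0 by rewrite map_poly_eq0.
have jq0 : map_poly j q != 0 by rewrite map_poly_eq0.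
have jl0 := jlN0 n; have [oP P0] := even_prod.
rewrite mupX // mupM ?expf_neq0 //; last by rewrite rmorphM mulf_neq0.
rewrite mupX // rmorphM mupM // !oddD /= oP mupl !addbF !addbb.
by move: yn; rewrite /odd_elts /= => ->.
Qed.

Hypothesis d_even : ~~ odd d.

Lemma portrait_dense (pi : seq 'I_d -> 'S_d) n :
  exists s, forall w, (size w < n)%N -> portrait s w = pi w.
Proof.
exact: (portrait_approx portrait_mul portrait_one portrait_mulV portrait_mulVl
  d_gt1 d_even portrait_even_stab disc_root_indep).
Qed.

End Independence.

(** * From portraits to automorphisms of the tree *)

Lemma iter_t_neq n : iter n.+1 (horner fM) t <> t.
Proof.
move=> cyc.
have /eqP : iter_poly f n.+1 - 'X = 0.
  apply: transcendental_t; move: (iter_polyE n.+1 t); rewrite cyc.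
  move: (iter_poly f n.+1) => q qE.
  by rewrite rmorphB hornerD hornerN /= map_polyX hornerX qE subrr.
rewrite subr_eq0 => /eqP itX; have := size_iter_poly n.+1.
rewrite itX size_polyX => -[dn].
by have := leq_pexp2l (ltnW d_gt1) (ltn0Sn n); rewrite -dn expn1 leqNgt d_gt1.
Qed.

Lemma vertex_of_size w w' : vertex_of w = vertex_of w' -> size w = size w'.
Proof.
wlog ww' : w w' / (size w <= size w')%N.
  by move=> wl; case/orP: (leq_total (size w) (size w')) => le eqv;
    [|apply/esym]; apply: wl.
move=> eqv; apply/eqP; rewrite eqn_leq ww' leqNgt; apply/negP => lt.
apply: (@iter_t_neq (size w' - size w).-1); rewrite prednK ?subn_gt0 //.
by rewrite -{1}(iter_vertex_of w) eqv -iterD subnK // iter_vertex_of.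
Qed.

Lemma iter_preimage n x : iter n (horner fM) x = t ->
  exists2 w, size w = n & x = vertex_of w.
Proof.
elim: n x => [|n IH] x; first by exists [::].
rewrite iterSr => /IH[w wn fx].
have [k ->] := preim_labelP (@transcendental_vertex w) fx.
by exists (k :: w); rewrite //= wn.
Qed.

Local Notation F := (ratfun_poly f).
Local Notation T := (ratfunX K).

Lemma root_level_poly n x :
  root (level_poly i F T n) x = (iter n (horner fM) x == t).
Proof.
rewrite /level_poly /root rmorphB /= map_polyC hornerD hornerN hornerC subr_eq0.
congr (_ == _); elim: n => [|n IH] /=; first by rewrite map_polyX hornerX.
by rewrite map_comp_poly horner_comp IH map_ratfun_poly.
Qed.

Lemma vertex_ofP w : exists n, root (level_poly i F T n) (vertex_of w).
Proof. by exists (size w); rewrite root_level_poly iter_vertex_of. Qed.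

Definition tree_vertex w : vertex i F T := exist _ (vertex_of w) (vertex_ofP w).

Lemma tree_vertex_surj (v : vertex i F T) : exists w, v = tree_vertex w.
Proof.
case: v => x xP; have [n] := xP; rewrite root_level_poly => /eqP/iter_preimage.
by case=> w _ xw; exists w; apply: vertex_inj.
Qed.

Lemma tree_vertex_inj : injective tree_vertex.
Proof.
move=> w w' /(congr1 sval) /= eqv; apply: vertex_of_inj => //.
exact: vertex_of_size.
Qed.

Section TreeAutomorphism.
Variable g : tree_aut i F T.

(** Adjacency is symmetric, so an edge might be reversed. At the root this would make t periodic;
    elsewhere a vertex and its grandparent would have the same image. *)
Lemma tree_aut_preimage k w :
  fM.[sval (g (tree_vertex (k :: w)))] = sval (g (tree_vertex w)).
Proof.
have gI := bij_inj (tree_bij g).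
have step l u : fM.[vertex_of (l :: u)] = vertex_of u.
  by rewrite horner_preim_label //; exact: transcendental_vertex.
have root0 : tree_vertex [::] = root_vertex i F T by exact: vertex_inj.
elim: w k => [|l w IH] k.
  have : adj (g (tree_vertex [:: k])) (g (tree_vertex [::])).
    by apply/tree_adj; left; rewrite map_ratfun_poly step.
  rewrite /adj map_ratfun_poly => -[//|].
  rewrite root0 tree_root /= => gk.
  have [n] := svalP (g (tree_vertex [:: k])); rewrite root_level_poly -gk -iterSr.
  by move/eqP/iter_t_neq.
have : adj (g (tree_vertex (k :: l :: w))) (g (tree_vertex (l :: w))).
  by apply/tree_adj; left; rewrite map_ratfun_poly step.
rewrite /adj map_ratfun_poly => -[//|]; rewrite IH => /vertex_inj/gI/tree_vertex_inj.
by move/(congr1 size)/eqP; rewrite /= -[X in X == _]addn0 -[X in _ == X]addn2 eqn_add2l.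
Qed.

Lemma tree_aut_portrait : exists pi : seq 'I_d -> 'S_d,
  forall w, g (tree_vertex w) = tree_vertex (word_act (fun=> pi) tt w).
Proof.
have /boolp.choice[h hP] : forall w, exists w', g (tree_vertex w) = tree_vertex w'.
  by move=> w; exact: tree_vertex_surj.
have h0 : h [::] = [::].
  apply: tree_vertex_inj; rewrite -hP.
  have -> : tree_vertex [::] = root_vertex i F T by exact: vertex_inj.
  exact: tree_root.
have hS k w : exists l, h (k :: w) = l :: h w.
  have := tree_aut_preimage k w; rewrite !hP /= => eqv.
  have [l hl] := preim_labelP (@transcendental_vertex (h w)) eqv.
  by exists l; apply: tree_vertex_inj; apply: vertex_inj.
have /boolp.choice[q qP] : forall w, exists p : 'S_d,
    forall k, h (k :: w) = p k :: h w.
  move=> w; have /boolp.choice[p pP] : forall k, exists l, h (k :: w) = l :: h w.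
    by move=> k; exact: hS.
  have p_inj : injective p.
    move=> k l pkl; have : tree_vertex (h (k :: w)) = tree_vertex (h (l :: w)).
      by rewrite !pP pkl.
    by rewrite -!hP => /(bij_inj (tree_bij g))/tree_vertex_inj[].
  by exists (perm p_inj) => k; rewrite permE.
exists q => w; rewrite hP; congr tree_vertex.
by elim: w => //= k w IH; rewrite qP IH.
Qed.

(** The [s n] agree with [g] up to level n. Each element of [M] has finitely many conjugates, so
    they have an ultralimit, and it agrees with [g] on every level. *)
Lemma tree_aut_galois :
  (forall (pi : seq 'I_d -> 'S_d) n,
     exists s, forall w, (size w < n)%N -> portrait s w = pi w) ->
  exists s : gal_aut i, arboreal_rep F T s = g.
Proof.
move=> dense; have [pi gpi] := tree_aut_portrait.
have /boolp.choice[s sP] := dense pi.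
have sE n w : (size w <= n)%N -> sval (g (tree_vertex w)) = s n (vertex_of w).
  rewrite gpi gal_vertex_of /= => wn; congr vertex_of.
  elim: w wn => //= k w IH wn; rewrite IH ?(ltnW wn) //.
  by rewrite (sP n).
have [|||U UU Uin] := @directed_ultrafilter nat 0 (fun m n => (m <= n)%N).
- exact: leqnn.
- by move=> x y z; exact: leq_trans.
- by move=> x y; exists (maxn x y); rewrite ?leq_maxl ?leq_maxr.
have UF : filter.ProperFilter U by case: UU.
have Uall (B : set nat) : (forall n, B n) -> U B by move=> Bn; apply: (Uin 0).
have [||||psi psiP] := @ultra_rmorphism _ U UU M M (fun n => s n).
- move=> x; have [q [_ qsep qx]] := M_closure.1 x.
  have [|l lP] := @finite_roots _ (map_poly i q).
    by rewrite map_poly_eq0; exact: separable_poly_neq0.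
  exists l; apply: Uall => n /=; apply: lP; apply/rootP.
  by rewrite -gal_map_poly (rootP qx) rmorph0.
- by move=> x y; apply: Uall => n /=; rewrite rmorphB.
- by move=> x y; apply: Uall => n /=; rewrite rmorphM.
- by apply: Uall => n /=; rewrite rmorph1.
have [y|s' s'E] := @gal_aut_of_rmorphism _ _ i M_closure psi.
  apply: (ultra_const UU); apply: filter.filterS (psiP (i y)) => n /= <-.
  exact: gal_fix.
exists s'; have gs' v : gal_vertex s' v = g v.
  have [w ->] := tree_vertex_surj v; apply: vertex_inj; rewrite /= s'E.
  apply: (ultra_const UU).
  apply: filter.filterS (filter.filterI (psiP (vertex_of w))
    (Uin (size w) [set n | (size w <= n)%N]%classic (fun n wn => wn))).
  by move=> n /= [<- wn]; rewrite (sE n).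
exact: tree_aut_eq.
Qed.

End TreeAutomorphism.

End Labelling.

(** * Surjectivity over K(t) *)

Theorem theorem3p1
  (K : fieldType) (charK : 2%N \notin [pchar K])
  (f : {poly K}) (d : nat) (deg_f : size f = d.+1) (d_ge2 : (2 <= d)%N)
  (d_even : ~~ odd d)
  (* E is the splitting field of f(x) - t over K(t), with d roots rs *)
  (E : splittingFieldType (ratfun K))
  (E_split : splittingFieldFor 1%VS
     (map_poly (in_alg E) (ratfun_poly f - (ratfunX K)%:P)) fullv)
  (rs : d.-tuple E) (rs_uniq : uniq rs)
  (rs_roots : forall x : E,
     (x \in rs) = root (map_poly (in_alg E) (ratfun_poly f - (ratfunX K)%:P)) x)
  (gal_E : gal_perms rs = ('Alt_('I_d))%g \/ gal_perms rs = ('Sym_('I_d))%g)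
  (* Omega is K^sep, or any other extension of K containing all roots of f' *)
  (Omega : fieldType) (j : {rmorphism K -> Omega})
  (Gamma : seq Omega) (Gamma_roots : root_multiset (map_poly j f^`()) Gamma)
  (Gamma_odd : forall n : nat,
     ~ (odd_elts (iter_multiset (map_poly j f) n Gamma) `<=`
        \bigcup_(k < n) odd_elts (iter_multiset (map_poly j f) k Gamma))%classic)
  (Lsep : fieldType) (i : {rmorphism ratfun K -> Lsep})
  (Lsep_closure : is_sep_closure i) :
  forall g : tree_aut i (ratfun_poly f) (ratfunX K),
    exists s : gal_aut i, arboreal_rep (ratfun_poly f) (ratfunX K) s = g.

Proof.
(* In both cases the Galois group of [E] induces all even permutations. *)
have even_gal p : ~~ odd_perm p -> p \in gal_perms rs.
  by case: gal_E => -> pe; rewrite ?Alt_even // inE.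
move=> g; exact: (tree_aut_galois g (portrait_dense deg_f d_ge2 E_split rs_uniq
  rs_roots even_gal Lsep_closure Gamma_roots Gamma_odd d_even)).
Qed.
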